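(* Let $$(A,B)=\bigoplus_{i=1}^l(F_{p_i}^T,G_{p_i}^T)\oplus(I,J^{\#})\oplus(J(0)^{\#},I)\oplus\bigoplus_{i=1}^r(F_{q_i},G_{q_i}),\qquad p_1\le\dots\le p_l,\quad q_1\ge\dots\ge q_r,$$ where $J^{\#}$ is the Weyr canonical form of a complex Jordan matrix $J$ (of size $n\times n$, with arbitrary eigenvalues) and $J(0)^{\#}$ is the Weyr canonical form of a Jordan matrix $J(0)$ (of size $n'\times n'$) with the single eigenvalue $0$. Then one of the block triangular simple miniversal deformations of $(A,B)$ (with respect to equivalence transformations of matrix pairs) has the form $(\mathcal A,\mathcal B)$, in which $$\mathcal A=\begin{bmatrix} F_{p_1}^T\oplus\dots\oplus F_{p_l}^T&0&0&0 \\ 0&I_n&0&0 \\ X&0&J(0)^{\#}+\mathcal H^{\#}&0 \\ Y&0&W&F_{q_1}\oplus\dots\oplus F_{q_r} \end{bmatrix},$$ $$\mathcal B=\begin{bmatrix} \mathcal G&0&0&0 \\ U&J^{\#}+\mathcal K^{\#}&0&0 \\ 0&0&I_{n'}&0 \\ V_1&V_2&0&\mathcal G' \end{bmatrix},$$ with $$X=[0^{\rightarrow}\ 0^{\rightarrow}\ \dots\ 0^{\rightarrow}],\qquad Y=[0^{\rightarrow}\ 0^{\rightarrow}\ \dots\ 0^{\rightarrow}],\qquad U=[0^{\leftarrow}\ 0^{\leftarrow}\ \dots\ 0^{\leftarrow}]$$ ($l$ blocks each; the $j$-th blocks have sizes $n'\times p_j$, $(q_1+\dots+q_r)\times p_j$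 and $n\times p_j$, respectively), $$W=\begin{bmatrix} 0^{\downarrow} \\ \vdots \\ 0^{\downarrow} \end{bmatrix},\qquad V_1=\begin{bmatrix} 0^{\uparrow} \\ \vdots \\ 0^{\uparrow} \end{bmatrix},\qquad V_2=\begin{bmatrix} 0^{\uparrow} \\ \vdots \\ 0^{\uparrow} \end{bmatrix}$$ ($r$ blocks each; the $i$-th blocks have sizes $q_i\times n'$, $q_i\times(p_1+\dots+p_l)$ and $q_i\times n$, respectively), and $$\mathcal G=\begin{bmatrix} G_{p_1}^T&&&0 \\ \mathcal Z^T&G_{p_2}^T&& \\ \vdots&\ddots&\ddots& \\ \mathcal Z^T&\dots&\mathcal Z^T&G_{p_l}^T \end{bmatrix},\qquad \mathcal G'=\begin{bmatrix} G_{q_1}&&&0 \\ \mathcal Z&G_{q_2}&& \\ \vdots&\ddots&\ddots& \\ \mathcal Z&\dots&\mathcal Z&G_{q_r} \end{bmatrix}.$$ Here $J(0)^{\#}+\mathcal H^{\#}$ and $J^{\#}+\mathcal K^{\#}$ are the block triangular miniversal deformations (under similarity) of $J(0)^{\#}$ and $J^{\#}$ described in the context.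
   Context: All matrices are complex. Any of the direct summands of $(A,B)$ may be absent, and matrices with zero rows or zero columns are allowed. Equivalence and deformations of pairs. Pairs of $m\times n$ matrices are considered up to equivalence $(A,B)\mapsto(S^{-1}AR,S^{-1}BR)$ with $S,R$ nonsingular. A deformation of $(A,B)$ is a pair of matrix functions $(\mathcal A,\mathcal B)(\alpha_1,\dots,\alpha_k)$ on a neighborhood of $\vec 0\in\mathbb C^k$, holomorphic at $\vec 0$ and equal to $(A,B)$ at $\vec 0$; deformations coinciding near $\vec 0$ are identified. It is versal if all pairs $(A+E_1,B+E_2)$ in some neighborhood of $(A,B)$ reduce to the form $$(\mathcal A,\mathcal B)(h_1(E),\dots,h_k(E))=\big(\mathcal S(E)^{-1}(A+E_1)\mathcal R(E),\ \mathcal S(E)^{-1}(B+E_2)\mathcal R(E)\big),\quad \mathcal S(0)=I,\ \mathcal R(0)=I,$$ where $E=(E_1,E_2)$ and $\mathcal S,\mathcal R$ are matrix functions of the entries of $E$ holomorphic at zero. It is miniversal if it is versal with the minimal number of parameters. It is simple if, writing it as $(A+\mathcal P,B+\mathcal Q)$, $k$ of the entries of $\mathcal P,\mathcal Q$ are the independent parameters $\alpha_1,\dots,\alpha_k$ and all other entries are zero. Block triangularity. The pair $(A,B)$ is partitioned so that $J^{\#}$ and $J(0)^{\#}$ are partitioned as described below, and all blocks of the summands $(F_{p_i}^T,G_{p_i}^T)$ and $(F_{q_i},G_{q_i})$ are $1\times1$. A simple deformation $(A+\mathcal P,B+\mathcal Q)$ is block triangular if $\mathcal P$ and $\mathcal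 Q$ are block triangular with respect to this partition and each of their blocks is either $0$ or has all entries independent parameters. Since the summands $F_{p_i}^T$ and $F_{q_i}$ are not square, (lower) block triangular is understood relative to the direct sum decomposition: with the direct summands in the listed order, the blocks of $\mathcal P$ and $\mathcal Q$ whose row strip belongs to an earlier summand than their column strip are zero; the diagonal blocks of $\mathcal P,\mathcal Q$ corresponding to $F_{p_i}^T,G_{p_i}^T,F_{q_i},G_{q_i}$ and to the summands $I$ are zero; and those corresponding to $J(0)^{\#}$ in $\mathcal P$ and to $J^{\#}$ in $\mathcal Q$ are lower block triangular with respect to the partitions of $J(0)^{\#}$ and $J^{\#}$. Matrices $F_r,G_r$. For $r\ge1$, $F_r$ and $G_r$ are the $r\times(r-1)$ matrices $$F_r=\begin{bmatrix} I_{r-1} \\ 0 \end{bmatrix},\qquad G_r=\begin{bmatrix} 0 \\ I_{r-1} \end{bmatrix}.$$ Parameter blocks. All stars denote independent parameters, and stars in different positions are distinct parameters. $0^{\uparrow},0^{\downarrow},0^{\leftarrow},0^{\rightarrow}$ denote matrices in which all entries of, respectively, the first row, the last row, the first column, the last column are stars and the other entries are zero. $\mathcal Z$ denotes a matrix whose first row has the form $( *,\dots,*,0,\dots,0)$, in which the number of zeros equals the number of rows of $\mathcal Z$, and whose other entries are zero; that is, for $\mathcal Z$ of size $a\times b$, the first $b-a$ entries of the first row are stars if $b>a$, and $\mathcal Z=0$ if $b\le a$. $\mathcal Z^T$ is the transpose of a matrix of this form. The $(i,j)$-block $\mathcal Z^T$ of $\mathcal G$ ($i>j$) has size $(p_i-1)\times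 p_j$; the $(i,j)$-block $\mathcal Z$ of $\mathcal G'$ ($i>j$) has size $q_i\times(q_j-1)$. Weyr form and its deformation. $J_m(\lambda)$ is the $m\times m$ Jordan block with ones above the diagonal. For natural numbers $p,q$, $\mathcal T_{pq}$ is the $p\times q$ matrix with stars in all positions of the first column if $p<q$, in all positions of the last row if $p\ge q$, and zeros elsewhere. For $J(\lambda)=J_{n_1}(\lambda)\oplus\dots\oplus J_{n_t}(\lambda)$ with $n_1\ge\dots\ge n_t$, let $\mathcal H=[\mathcal T_{n_i,n_j}]_{i,j=1}^t$. Permute the first columns of $J_{n_1}(\lambda),\dots,J_{n_t}(\lambda)$ (in order) into the first $t$ columns and permute the rows correspondingly; next permute the second columns of all blocks of size at least $2\times2$ (in order) into the next columns and permute the rows correspondingly; and so on. The result of this simultaneous permutation of rows and columns applied to $J(\lambda)$ is its Weyr canonical form $J(\lambda)^{\#}$; applied to $J(\lambda)+\mathcal H$ it gives $J(\lambda)^{\#}+\mathcal H^{\#}$. For $J=J(\lambda_1)\oplus\dots\oplus J(\lambda_\tau)$ with distinct $\lambda_i$, put $J^{\#}=J(\lambda_1)^{\#}\oplus\dots\oplus J(\lambda_\tau)^{\#}$ and $J^{\#}+\mathcal K^{\#}=(J(\lambda_1)^{\#}+\mathcal H_1^{\#})\oplus\dots\oplus(J(\lambda_\tau)^{\#}+\mathcal H_\tau^{\#})$, where $\mathcal H_i$ is the matrix $\mathcal H$ built for $J(\lambda_i)$. The partition of $J^{\#}$ is the coarsest one (the same for rows and columns) for which all diagonal blocks have the form $\lambda_iI$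 and each off-diagonal block is $0$ or $I$: for $J(\lambda)^{\#}$, if $s_i$ is the number of Jordan blocks of size at least $i$ and $k$ is the largest block size, the sizes of the diagonal blocks are obtained from $s_k,s_{k-1}-s_k,\dots,s_1-s_2;\ s_k,s_{k-1}-s_k,\dots,s_2-s_3;\ \dots;\ s_k,s_{k-1}-s_k;\ s_k$ by removing zeros; for several eigenvalues the partitions are concatenated. *)

(* Defs.v *)
From HB Require Import structures.
From mathcomp Require Import all_boot all_order all_algebra.
From mathcomp Require Import complex.
From mathcomp Require Import all_classical all_reals all_analysis.

Set Implicit Arguments.
Unset Strict Implicit.
Unset Printing Implicit Defensive.

Import Order.TTheory GRing.Theory Num.Theory.
Import numFieldNormedType.Exports.

Local Open Scope classical_set_scope.
Local Open Scope ring_scope.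
Local Open Scope complex_scope.

(* The field of complex numbers over the reals R, as a numFieldType, the
   structure to which MathComp-Analysis attaches norm and topology. *)
Definition Cplx (R : realType) : numFieldType := R[i].

(* "Holomorphic at zero" is complex (Fréchet) differentiability on a
   neighborhood of 0. *)
Definition holomorphic_at0 (R : realType) (V W : normedModType (Cplx R))
    (f : V -> W) : Prop :=
  \forall x \near (0 : V), differentiable f x.

Definition mx_pair (R : realType) (m n : nat) : normedModType (Cplx R) :=
  ('M[Cplx R]_(m, n) * 'M[Cplx R]_(m, n))%type.

Definition deformation (R : realType) (m n k : nat) (A B : 'M[Cplx R]_(m, n))
    (D : 'rV[Cplx R]_k -> mx_pair R m n) : Prop :=
  holomorphic_at0 D /\ D 0 = (A, B).

(* Q(E) is the factor R(E) on the right; S(E) and Q(E) are nonsingular near 0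
   by continuity.  A deformation is a germ at 0, so the parameters h(E) have to
   stay near 0 when E does; as in Arnold's definition, h is holomorphic at zero
   with h(0) = 0. *)
Definition versal (R : realType) (m n k : nat) (A B : 'M[Cplx R]_(m, n))
    (D : 'rV[Cplx R]_k -> mx_pair R m n) : Prop :=
  deformation A B D /\
  exists (h : mx_pair R m n -> 'rV[Cplx R]_k)
         (S : mx_pair R m n -> 'M[Cplx R]_m)
         (Q : mx_pair R m n -> 'M[Cplx R]_n),
    [/\ holomorphic_at0 h /\ h 0 = 0,
        holomorphic_at0 S /\ S 0 = 1%:M,
        holomorphic_at0 Q /\ Q 0 = 1%:M
      & \forall E \near (0 : mx_pair R m n),
          D (h E) = (invmx (S E) *m (A + E.1) *m Q E,
                     invmx (S E) *m (B + E.2) *m Q E)].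

Definition miniversal (R : realType) (m n k : nat) (A B : 'M[Cplx R]_(m, n))
    (D : 'rV[Cplx R]_k -> mx_pair R m n) : Prop :=
  versal A B D /\
  forall (k' : nat) (D' : 'rV[Cplx R]_k' -> mx_pair R m n),
    versal A B D' -> (k <= k')%N.

(* A star pattern is a boolean matrix, [true] standing for a star.
   [star_deformation A B SP SQ D] says that D = (A + P, B + Q) where the entries
   of P (resp. Q) at the stars of SP (resp. SQ) are the k independent parameters,
   each used exactly once, and the other entries are zero; [pos t] is the place
   of the t-th parameter, [inl] in P and [inr] in Q. *)
Definition star_deformation (R : realType) (m n k : nat)
    (A B : 'M[Cplx R]_(m, n)) (SP SQ : 'M[bool]_(m, n))
    (D : 'rV[Cplx R]_k -> mx_pair R m n) : Prop :=
  exists pos : 'I_k -> ('I_m * 'I_n) + ('I_m * 'I_n),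
    [/\ injective pos,
        forall i j, SP i j = (inl (i, j) \in codom pos),
        forall i j, SQ i j = (inr (i, j) \in codom pos)
      & \forall a \near (0 : 'rV[Cplx R]_k),
          D a = (A + \matrix_(i, j) \sum_(t < k | pos t == inl (i, j)) a 0 t,
                 B + \matrix_(i, j) \sum_(t < k | pos t == inr (i, j)) a 0 t)].

Definition simple_deformation (R : realType) (m n k : nat)
    (A B : 'M[Cplx R]_(m, n))
    (D : 'rV[Cplx R]_k -> mx_pair R m n) : Prop :=
  deformation A B D /\ exists SP SQ, star_deformation A B SP SQ D.

(* Each row i and column j carries a label (summand, strip): the number of the
   direct summand that contains it and the number of its strip inside this
   summand.  Only the diagonal block of the summand d may be nonzero. *)
Definition block_triangular_pattern (m n : nat) (rl : 'I_m -> nat * nat)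
    (cl : 'I_n -> nat * nat) (d : nat) (S : 'M[bool]_(m, n)) : Prop :=
  [/\ forall i i' j j', rl i = rl i' -> cl j = cl j' -> S i j = S i' j',
      forall i j, S i j -> ((cl j).1 <= (rl i).1)%N
    & forall i j, S i j -> (rl i).1 = (cl j).1 ->
        (rl i).1 = d /\ ((cl j).2 <= (rl i).2)%N].

Definition block_triangular (R : realType) (m n k : nat)
    (rl : 'I_m -> nat * nat) (cl : 'I_n -> nat * nat) (dP dQ : nat)
    (A B : 'M[Cplx R]_(m, n))
    (D : 'rV[Cplx R]_k -> mx_pair R m n) : Prop :=
  exists SP SQ, [/\ star_deformation A B SP SQ D,
    block_triangular_pattern rl cl dP SP
  & block_triangular_pattern rl cl dQ SQ].

(* Direct sum of possibly rectangular blocks ([\mxdiag] needs square ones);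
   [conform_mx] only casts M i from (m i, n i) to (m i, n j) for i = j. *)
Definition dsum (T : Type) (z : T) (l : nat) (m n : 'I_l -> nat)
    (M : forall i, 'M[T]_(m i, n i)) : 'M[T]_(\sum_i m i, \sum_i n i) :=
  \mxblock_(i < l, j < l)
    (if i == j then conform_mx (const_mx z) (M i) else const_mx z).

Definition block4 (T : Type) (m1 m2 m3 m4 n1 n2 n3 n4 : nat)
    (A11 : 'M[T]_(m1, n1)) (A12 : 'M[T]_(m1, n2))
    (A13 : 'M[T]_(m1, n3)) (A14 : 'M[T]_(m1, n4))
    (A21 : 'M[T]_(m2, n1)) (A22 : 'M[T]_(m2, n2))
    (A23 : 'M[T]_(m2, n3)) (A24 : 'M[T]_(m2, n4))
    (A31 : 'M[T]_(m3, n1)) (A32 : 'M[T]_(m3, n2))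
    (A33 : 'M[T]_(m3, n3)) (A34 : 'M[T]_(m3, n4))
    (A41 : 'M[T]_(m4, n1)) (A42 : 'M[T]_(m4, n2))
    (A43 : 'M[T]_(m4, n3)) (A44 : 'M[T]_(m4, n4)) :
    'M[T]_(m1 + (m2 + (m3 + m4)), n1 + (n2 + (n3 + n4))) :=
  col_mx (row_mx A11 (row_mx A12 (row_mx A13 A14)))
 (col_mx (row_mx A21 (row_mx A22 (row_mx A23 A24)))
 (col_mx (row_mx A31 (row_mx A32 (row_mx A33 A34)))
         (row_mx A41 (row_mx A42 (row_mx A43 A44))))).

Definition F_mx (K : pzRingType) (r : nat) : 'M[K]_(r, r.-1) := pid_mx r.-1.

Definition G_mx (K : pzRingType) (r : nat) : 'M[K]_(r, r.-1) :=
  \matrix_(i, j) (i == j.+1 :> nat)%:R.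

Definition jordan_block (K : pzRingType) (a : K) (m : nat) : 'M[K]_m :=
  \matrix_(i, j) (a *+ (i == j) + (j == i.+1 :> nat)%:R).

Definition jordan_mx (K : pzRingType) (a : K) (t : nat) (ns : 'I_t -> nat) :
    'M[K]_(\sum_i ns i) :=
  \mxdiag_(i < t) jordan_block a (ns i).

Definition T_stars (p q : nat) : 'M[bool]_(p, q) :=
  \matrix_(i, j) (if (p < q)%N then j == 0 :> nat else i.+1 == p).

Definition H_stars (t : nat) (ns : 'I_t -> nat) :
    'M[bool]_(\sum_i ns i, \sum_i ns i) :=
  \mxblock_(i < t, j < t) T_stars (ns i) (ns j).

(* The index x of [\sum_i ns i] is the position [tagnat.sig2 x] of the Jordan
   block number [tagnat.sig1 x]; the Weyr order lists first the first positions
   of all blocks, then their second positions, and so on. *)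
Definition weyr_order (t : nat) (ns : 'I_t -> nat) : seq 'I_(\sum_i ns i) :=
  sort (fun x y => (tagnat.sig2 x < tagnat.sig2 y)%N ||
          ((tagnat.sig2 x == tagnat.sig2 y :> nat) &&
           (tagnat.sig1 x <= tagnat.sig1 y)%N))
       (enum 'I_(\sum_i ns i)).

(* The default value of [nth] is never used: [weyr_order ns] has \sum_i ns i
   entries. *)
Definition weyr_index (t : nat) (ns : 'I_t -> nat) (x : 'I_(\sum_i ns i)) :
    'I_(\sum_i ns i) :=
  nth x (weyr_order ns) x.

Definition weyr_permute (T : Type) (t : nat) (ns : 'I_t -> nat)
    (M : 'M[T]_(\sum_i ns i)) : 'M[T]_(\sum_i ns i) :=
  mxsub (@weyr_index t ns) (@weyr_index t ns) M.

(* J(a)^# and the stars of H^#. *)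
Definition weyr_mx (K : pzRingType) (a : K) (t : nat) (ns : 'I_t -> nat) :
    'M[K]_(\sum_i ns i) :=
  weyr_permute (jordan_mx a ns).

Definition weyr_stars (t : nat) (ns : 'I_t -> nat) : 'M[bool]_(\sum_i ns i) :=
  weyr_permute (H_stars ns).

(* The sizes of the diagonal blocks in the partition of J(a)^#, with
   s b the number of Jordan blocks of size at least b. *)
Definition weyr_partition (t : nat) (ns : 'I_t -> nat) : seq nat :=
  let s b := #|[set i : 'I_t | (b <= ns i)%N]| in
  let k := \max_(i < t) ns i in
  [seq d <- flatten [seq [seq (s b - s b.+1)%N | b <- rev (iota a (k.+1 - a))]
                    | a <- iota 1 k]
  | (0 < d)%N].

Section Pattern.
Local Open Scope nat_scope.

Definition first_row (m n : nat) : 'M[bool]_(m, n) :=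
  \matrix_(i, j) (i == 0 :> nat).
Definition last_row (m n : nat) : 'M[bool]_(m, n) :=
  \matrix_(i, j) (i.+1 == m).
Definition first_col (m n : nat) : 'M[bool]_(m, n) :=
  \matrix_(i, j) (j == 0 :> nat).
Definition last_col (m n : nat) : 'M[bool]_(m, n) :=
  \matrix_(i, j) (j.+1 == n).

Definition Z_stars (a b : nat) : 'M[bool]_(a, b) :=
  \matrix_(i, j) ((i == 0 :> nat) && (j < b - a)).

End Pattern.

Definition rows_dim (l r : nat) (p : 'I_l -> nat) (q : 'I_r -> nat)
    (n n' : nat) : nat :=
  ((\sum_i (p i).-1) + (n + (n' + \sum_i q i)))%N.

Definition cols_dim (l r : nat) (p : 'I_l -> nat) (q : 'I_r -> nat)
    (n n' : nat) : nat :=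
  ((\sum_i p i) + (n + (n' + \sum_i (q i).-1)))%N.

Definition canon_A (K : pzRingType) (l r : nat) (p : 'I_l -> nat)
    (q : 'I_r -> nat) (n n' : nat) (J0 : 'M[K]_n') :
    'M[K]_(rows_dim p q n n', cols_dim p q n n') :=
  block4 (dsum 0 (fun i => (F_mx K (p i))^T)) 0 0 0
         0 (1%:M : 'M[K]_n) 0 0
         0 0 J0 0
         0 0 0 (dsum 0 (fun i => F_mx K (q i))).

Definition canon_B (K : pzRingType) (l r : nat) (p : 'I_l -> nat)
    (q : 'I_r -> nat) (n n' : nat) (J : 'M[K]_n) :
    'M[K]_(rows_dim p q n n', cols_dim p q n n') :=
  block4 (dsum 0 (fun i => (G_mx K (p i))^T)) 0 0 0
         0 J 0 0
         0 0 (1%:M : 'M[K]_n') 0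
         0 0 0 (dsum 0 (fun i => G_mx K (q i))).

(* The places of the independent parameters in the two deformed matrices; H and
   K are those in the deformations of J(0)^# and J^#. *)
Definition stars_A (l r : nat) (p : 'I_l -> nat) (q : 'I_r -> nat) (n n' : nat)
    (H : 'M[bool]_n') : 'M[bool]_(rows_dim p q n n', cols_dim p q n n') :=
  let O a b : 'M[bool]_(a, b) := const_mx false in
  let X := \mxrow_(j < l) last_col n' (p j) in
  let Y := \mxrow_(j < l) last_col (\sum_(i < r) q i) (p j) in
  let W := \mxcol_(i < r) last_row (q i) n' in
  block4 (O _ _) (O _ _) (O _ _) (O _ _)
         (O n _) (O _ _) (O _ _) (O _ _)
         X       (O _ _) H       (O _ _)
         Y       (O _ _) W       (O _ _).

Definition stars_B (l r : nat) (p : 'I_l -> nat) (q : 'I_r -> nat) (n n' : nat)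
    (K : 'M[bool]_n) : 'M[bool]_(rows_dim p q n n', cols_dim p q n n') :=
  let O a b : 'M[bool]_(a, b) := const_mx false in
  let U := \mxrow_(j < l) first_col n (p j) in
  let V1 := \mxcol_(i < r) first_row (q i) (\sum_(j < l) p j) in
  let V2 := \mxcol_(i < r) first_row (q i) n in
  let G := \mxblock_(i < l, j < l)
    (if (j < i)%N then (Z_stars (p j) (p i).-1)^T else O (p i).-1 (p j)) in
  let G' := \mxblock_(i < r, j < r)
    (if (j < i)%N then Z_stars (q i) (q j).-1 else O (q i) (q j).-1) in
  block4 G  (O _ _) (O _ _)  (O _ _)
         U  K       (O _ _)  (O _ _)
         (O _ _) (O _ _) (O n' n') (O _ _)
         V1 V2      (O _ _)  G'.

(* Labels of rows and columns: if [sizes] are the numbers of rows (columns) of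
   the direct summands in the listed order, the summands number l and l.+1 being
   (I, J^#) and (J(0)^#, I), the strips are given by the partitions wJ and wJ0
   in these two and are single rows (columns) in the others. *)
Definition label (sizes : seq nat) (l : nat) (wJ wJ0 : seq nat) (x : nat) :
    nat * nat :=
  let s := reshape_index sizes x in
  let o := reshape_offset sizes x in
  (s, if s == l then reshape_index wJ o
      else if s == l.+1 then reshape_index wJ0 o else o).

Definition row_label (l r : nat) (p : 'I_l -> nat) (q : 'I_r -> nat)
    (n n' : nat) (wJ wJ0 : seq nat) (x : 'I_(rows_dim p q n n')) : nat * nat :=
  label ([seq (p i).-1 | i <- enum 'I_l] ++ [:: n; n']
         ++ [seq q i | i <- enum 'I_r]) l wJ wJ0 x.

Definition col_label (l r : nat) (p : 'I_l -> nat) (q : 'I_r -> nat)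
    (n n' : nat) (wJ wJ0 : seq nat) (x : 'I_(cols_dim p q n n')) : nat * nat :=
  label ([seq p i | i <- enum 'I_l] ++ [:: n; n']
         ++ [seq (q i).-1 | i <- enum 'I_r]) l wJ wJ0 x.

(* Main.v *)
Require Import Defs.
From HB Require Import structures.
From mathcomp Require Import all_boot all_order all_algebra.
From mathcomp Require Import complex.
From mathcomp Require Import all_classical all_reals all_analysis.
From mathcomp Require Import zify ring lra.

Set Implicit Arguments.
Unset Strict Implicit.
Unset Printing Implicit Defensive.

Import Order.TTheory GRing.Theory Num.Theory.
Import numFieldNormedType.Exports.

Local Open Scope classical_set_scope.
Local Open Scope ring_scope.
Local Open Scope complex_scope.

(** The tangent space at [(A, B)] to its orbit under equivalence consists of the
    pairs [(s A - A x, s B - B x)]. The theorem holds because the pairs carried by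
    the stars form a direct complement of this space, which is what the predicate
    [complement] expresses. That the stars have this property is linear algebra;
    that it implies miniversality is analysis.

    Linear algebra. For a direct sum of pairs the tangent space splits into one
    piece for each pair of summands, so that [complement_canon] only has to treat
    two summands at a time. For [(I, C)] against [(I, C')] one unknown is
    eliminated and the question becomes the deformation of matrices under
    similarity, solved for Jordan blocks in [complement_jordan_block] and carried
    to the Weyr form by a permutation. For most of the other pairs of summands
    the equations reduce to [s - C s N = c] with [N] nilpotent, which has exactly
    one solution ([steinr], [stein_inj]); the star patterns say which entries are
    lost in this reduction. The pair of two summands [(F^T, G^T)] is different:
    its equations link the unknowns along diagonals, and the stars of Z^T
    mark the overdetermined diagonals ([complement_L_L]). Transposition gives the
    statements for [(F, G)].

    Analysis. Any star pattern that is a direct complement defines a miniversal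
    deformation ([complement_star_miniversal]). To reduce [(A + E1, B + E2)] one
    looks for [S = 1 + s], [Q = 1 + x] and [P] in the star space with
    [S (A + P) = (A + E1) Q] and the same equation for [B]. A linear right
    inverse of the tangent map expresses [s], [x], [P] by one pair of
    matrices [w], and the equations become [w = E + b(E, w) + q(w, w)] with [b]
    and [q] bilinear. For small [E] this is a contraction in [w], and its fixed
    point depends holomorphically on [E] ([quadratic_solution_local]).
    For minimality, the reduction to another versal deformation is differentiated
    at zero: the tangent space and the image of the differential of that
    deformation together span all pairs, so that this deformation has at least as
    many parameters as the codimension of the tangent space
    ([complement_minimal]).

    Block triangularity is combinatorial: in the Weyr form the rows are sorted by
    their position in the Jordan block and then by decreasing size of this
    block, and a strip consists of the rows for which both numbers agree
    ([weyr_strip_lt], [weyr_strip_eq]); the stars of a Jordan block depend on these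
    two numbers only. *)

(** * Complements of tangent spaces *)

Section Complement.
Variable K : fieldType.

Definition supported (m n : nat) (S : 'M[bool]_(m, n)) (M : 'M[K]_(m, n)) :=
  forall i j, ~~ S i j -> M i j = 0.

Definition no_stars (m n : nat) : 'M[bool]_(m, n) := const_mx false.

(** The matrices [s *m A2 - A1 *m x], [s *m B2 - B1 *m x] are the blocks of the
    tangent vectors to the orbit of a direct sum of pairs, in the row strip of
    the summand [(A1, B1)] and the column strip of the summand [(A2, B2)]; the
    pairs of matrices carried by the stars have to form a direct complement. *)
Definition complement (m1 n1 m2 n2 : nat) (A1 B1 : 'M[K]_(m1, n1))
    (A2 B2 : 'M[K]_(m2, n2)) (SP SQ : 'M[bool]_(m1, n2)) : Prop :=
  (forall M N, exists s x, supported SP (M - (s *m A2 - A1 *m x)) /\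
                           supported SQ (N - (s *m B2 - B1 *m x))) /\
  (forall s x, supported SP (s *m A2 - A1 *m x) ->
               supported SQ (s *m B2 - B1 *m x) ->
     s *m A2 = A1 *m x /\ s *m B2 = B1 *m x).

Lemma supported0 m n (S : 'M[bool]_(m, n)) : supported S 0.
Proof. by move=> i j _; rewrite mxE. Qed.

Lemma supported_no_stars m n (M : 'M[K]_(m, n)) :
  supported (no_stars m n) M <-> M = 0.
Proof.
split=> [sM|->]; last exact: supported0.
by apply/matrixP=> i j; rewrite sM mxE.
Qed.

Lemma supported_tr m n (S : 'M[bool]_(m, n)) M :
  supported S^T M^T <-> supported S M.
Proof. by split=> sM i j; have := sM j i; rewrite !mxE. Qed.

Lemma supportedN m n (S : 'M[bool]_(m, n)) M :
  supported S (- M) <-> supported S M.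
Proof.
split=> sM i j Sij; last by rewrite mxE sM ?oppr0.
by have := sM i j Sij; rewrite mxE => /eqP; rewrite oppr_eq0 => /eqP.
Qed.

Lemma supported_mxsub m n m' n' (S : 'M[bool]_(m, n)) M
    (f : 'I_m' -> 'I_m) (g : 'I_n' -> 'I_n) :
  bijective f -> bijective g ->
  supported (mxsub f g S) (mxsub f g M) <-> supported S M.
Proof.
move=> [f' fK f'K] [g' gK g'K]; split=> sM i j.
  by have := sM (f' i) (g' j); rewrite !mxE f'K g'K.
by rewrite !mxE; apply: sM.
Qed.

Lemma supported_col_mx m m' n (S : 'M[bool]_(m, n)) (S' : 'M[bool]_(m', n)) M M' :
  supported (col_mx S S') (col_mx M M') <-> supported S M /\ supported S' M'.
Proof.
split=> [sM|[sM sM'] i j].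
  split=> i j; first by have := sM (lshift _ i) j; rewrite !col_mxEu.
  by have := sM (rshift _ i) j; rewrite !col_mxEd.
by case: (split_ordP i) => k ->; rewrite ?col_mxEu ?col_mxEd;
  [apply: sM | apply: sM'].
Qed.

Lemma supported_mxcol t (p_ : 'I_t -> nat) n
    (S : forall i, 'M[bool]_(p_ i, n)) (M : forall i, 'M[K]_(p_ i, n)) :
  supported (\mxcol_i S i) (\mxcol_i M i) <-> forall i, supported (S i) (M i).
Proof.
split=> [sM k i j|sM i j]; last by rewrite !mxE; apply: sM.
have := sM (tagnat.Rank k i) j.
have E T (X : forall i, 'M[T]_(p_ i, n)) :
    (\mxcol_i X i) (tagnat.Rank k i) j = X k i j.
  by rewrite -[in RHS](mxcolK X k) [RHS]mxE.
by rewrite !E.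
Qed.

Lemma complement_swap m1 n1 m2 n2 (A1 B1 : 'M[K]_(m1, n1)) (A2 B2 : 'M[K]_(m2, n2))
    SP SQ :
  complement A1 B1 A2 B2 SP SQ -> complement B1 A1 B2 A2 SQ SP.
Proof.
case=> ex un; split=> [M N|s x sP sQ]; last by case: (un s x sQ sP).
by have [s [x []]] := ex N M; exists s, x.
Qed.

(** Transposition exchanges the roles of [s] and [x], up to sign; every
    result on the summands [(F^T, G^T)] thus has a mirror image for [(F, G)]. *)
Lemma complement_tr m1 n1 m2 n2 (A1 B1 : 'M[K]_(m1, n1)) (A2 B2 : 'M[K]_(m2, n2))
    SP SQ :
  complement A1 B1 A2 B2 SP SQ -> complement A2^T B2^T A1^T B1^T SP^T SQ^T.
Proof.
case=> ex un; split=> [M N|s x sP sQ].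
  have [s [x [sP sQ]]] := ex M^T N^T; exists (- x^T), (- s^T).
  have E (X : 'M[K]_(n2, m1)) (C : 'M[K]_(m1, n1)) (C' : 'M[K]_(m2, n2)) :
      X - (- x^T *m C^T - C'^T *m - s^T) = (X^T - (s *m C' - C *m x))^T.
    rewrite !raddfB /= !trmxK !trmx_mul mulNmx mulmxN opprK.
    by rewrite [- _ + _]addrC.
  by rewrite !E; split; apply/supported_tr.
have E (A : 'M[K]_(m1, n1)) (A' : 'M[K]_(m2, n2)) :
    s *m A^T - A'^T *m x = - (x^T *m A' - A *m s^T)^T.
  by rewrite raddfB /= !trmx_mul !trmxK opprB.
move: sP sQ; rewrite !E => /supportedN/supported_tr sP /supportedN/supported_tr.
move=> /(un _ _ sP)[eA eB].
by split; apply: trmx_inj; rewrite !trmx_mul !trmxK.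
Qed.

Lemma mxsub_mul m n k m' n' k' (f : 'I_m' -> 'I_m) (g : 'I_n' -> 'I_n)
    (h : 'I_k' -> 'I_k) (X : 'M[K]_(m, n)) (Y : 'M[K]_(n, k)) :
  bijective g -> mxsub f g X *m mxsub g h Y = mxsub f h (X *m Y).
Proof.
move=> gbij; apply/matrixP=> i j; rewrite !mxE [RHS](reindex g) /=; last first.
  exact: onW_bij.
by apply: eq_bigr => l _; rewrite !mxE.
Qed.

Lemma mxsub_surj m n m' n' (f : 'I_m' -> 'I_m) (g : 'I_n' -> 'I_n)
    (X : 'M[K]_(m', n')) :
  bijective f -> bijective g -> exists Y, X = mxsub f g Y.
Proof.
move=> [f' fK f'K] [g' gK g'K]; exists (mxsub f' g' X).
by apply/matrixP=> i j; rewrite !mxE fK gK.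
Qed.

(** A renumbering of rows and columns changes [s] and [x] by permutations; this
    is what reduces the Weyr form to the Jordan form. *)
Lemma complement_mxsub m1 n1 m2 n2 m1' n1' m2' n2' (A1 B1 : 'M[K]_(m1, n1))
    (A2 B2 : 'M[K]_(m2, n2)) SP SQ (f1 : 'I_m1' -> 'I_m1) (g1 : 'I_n1' -> 'I_n1)
    (f2 : 'I_m2' -> 'I_m2) (g2 : 'I_n2' -> 'I_n2) :
  bijective f1 -> bijective g1 -> bijective f2 -> bijective g2 ->
  complement A1 B1 A2 B2 SP SQ ->
  complement (mxsub f1 g1 A1) (mxsub f1 g1 B1) (mxsub f2 g2 A2) (mxsub f2 g2 B2)
    (mxsub f1 g2 SP) (mxsub f1 g2 SQ).
Proof.
move=> f1b g1b f2b g2b [ex un]; split=> [M N|s x].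
  have [M' ->] := mxsub_surj M f1b g2b; have [N' ->] := mxsub_surj N f1b g2b.
  have [s [x [sP sQ]]] := ex M' N'; exists (mxsub f1 f2 s), (mxsub g1 g2 x).
  by rewrite !mxsub_mul // -!raddfB; split; apply/supported_mxsub.
have [s' ->] := mxsub_surj s f1b f2b; have [x' ->] := mxsub_surj x g1b g2b.
rewrite !mxsub_mul // -!raddfB.
by move=> /supported_mxsub sP /supported_mxsub sQ;
  case: (un s' x') => [||-> ->]; auto.
Qed.

(** The rows of [s] and [x] that belong to different summands of the first pair
    are never mixed by the equations. *)
Lemma complement_col m1 n1 m1' n1' m2 n2 (A1 B1 : 'M[K]_(m1, n1))
    (A1' B1' : 'M[K]_(m1', n1')) (A2 B2 : 'M[K]_(m2, n2)) SP SQ SP' SQ' :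
  complement A1 B1 A2 B2 SP SQ -> complement A1' B1' A2 B2 SP' SQ' ->
  complement (block_mx A1 0 0 A1') (block_mx B1 0 0 B1') A2 B2
    (col_mx SP SP') (col_mx SQ SQ').
Proof.
move=> [ex un] [ex' un'].
have E (s : 'M[K]_(m1, m2)) (s' : 'M[K]_(m1', m2)) (x : 'M[K]_(n1, n2)) (x' : 'M[K]_(n1', n2))
    (C : 'M[K]_(m2, n2)) (D : 'M[K]_(m1, n1)) (D' : 'M[K]_(m1', n1')) :
  col_mx s s' *m C - block_mx D 0 0 D' *m col_mx x x' =
  col_mx (s *m C - D *m x) (s' *m C - D' *m x').
  by rewrite mul_block_col mul_col_mx !mul0mx addr0 add0r opp_col_mx add_col_mx.
split=> [M N|s x].
  rewrite -(vsubmxK M) -(vsubmxK N).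
  have [s [x [sP sQ]]] := ex (usubmx M) (usubmx N).
  have [s' [x' [sP' sQ']]] := ex' (dsubmx M) (dsubmx N).
  exists (col_mx s s'), (col_mx x x').
  by rewrite !E !opp_col_mx !add_col_mx; split; apply/supported_col_mx.
rewrite -(vsubmxK s) -(vsubmxK x) !E.
move=> /supported_col_mx[sP sP'] /supported_col_mx[sQ sQ'].
have [e1 e2] := un _ _ sP sQ; have [e1' e2'] := un' _ _ sP' sQ'.
by rewrite !mul_block_col !mul_col_mx !mul0mx !addr0 !add0r e1 e2 e1' e2'.
Qed.

Lemma complement_row m1 n1 m2 n2 m2' n2' (A1 B1 : 'M[K]_(m1, n1))
    (A2 B2 : 'M[K]_(m2, n2)) (A2' B2' : 'M[K]_(m2', n2')) SP SQ SP' SQ' :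
  complement A1 B1 A2 B2 SP SQ -> complement A1 B1 A2' B2' SP' SQ' ->
  complement A1 B1 (block_mx A2 0 0 A2') (block_mx B2 0 0 B2')
    (row_mx SP SP') (row_mx SQ SQ').
Proof.
move=> /complement_tr c /complement_tr c'.
have := complement_tr (complement_col c c').
by rewrite !tr_block_mx !trmx0 !trmxK !tr_col_mx !trmxK.
Qed.

Lemma mul_dsum_mxcol t (m_ n_ : 'I_t -> nat) k (D : forall i, 'M[K]_(m_ i, n_ i))
    (X : forall i, 'M[K]_(n_ i, k)) :
  dsum 0 D *m \mxcol_i X i = \mxcol_i (D i *m X i).
Proof.
rewrite /dsum mul_mxblock_mxrow; apply: eq_mxcol => i.
rewrite (bigD1 i) //= eqxx conform_mx_id big1 ?addr0 // => j ji.
by rewrite eq_sym (negPf ji) (_ : const_mx 0 = 0) ?mul0mx.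
Qed.

Lemma tr_dsum T (z : T) t (m_ n_ : 'I_t -> nat) (D : forall i, 'M[T]_(m_ i, n_ i)) :
  (dsum z D)^T = dsum z (fun i => (D i)^T).
Proof.
rewrite /dsum tr_mxblock; apply/eq_mxblock => i j.
rewrite eq_sym; case: eqP => [->|_]; rewrite ?conform_mx_id //.
by apply/matrixP=> a b; rewrite !mxE.
Qed.

Lemma complement_mxcol t (m_ n_ : 'I_t -> nat) m2 n2
    (A1 B1 : forall i, 'M[K]_(m_ i, n_ i)) (A2 B2 : 'M[K]_(m2, n2)) SP SQ :
  (forall i, complement (A1 i) (B1 i) A2 B2 (SP i) (SQ i)) ->
  complement (dsum 0 A1) (dsum 0 B1) A2 B2 (\mxcol_i SP i) (\mxcol_i SQ i).
Proof.
move=> cmp; split=> [M N|s x].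
  have /(_ _)/cid-/all_sig[s sP] i := (cmp i).1 (submxcol M i) (submxcol N i).
  have /(_ _)/cid-/all_sig[x xP] i := sP i.
  exists (\mxcol_i s i), (\mxcol_i x i).
  rewrite -(submxcolK M) -(submxcolK N) !mul_dsum_mxcol !mxcol_mul -!mxcolB.
  by split; apply/supported_mxcol => i; case: (xP i).
rewrite -(submxcolK s) -(submxcolK x) !mul_dsum_mxcol !mxcol_mul -!mxcolB.
move=> /supported_mxcol sP /supported_mxcol sQ.
by split; apply: eq_mxcol => i; case: ((cmp i).2 _ _ (sP i) (sQ i)).
Qed.

Lemma complement_mxrow t (m_ n_ : 'I_t -> nat) m1 n1 (A1 B1 : 'M[K]_(m1, n1))
    (A2 B2 : forall i, 'M[K]_(m_ i, n_ i)) SP SQ :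
  (forall i, complement A1 B1 (A2 i) (B2 i) (SP i) (SQ i)) ->
  complement A1 B1 (dsum 0 A2) (dsum 0 B2) (\mxrow_i SP i) (\mxrow_i SQ i).
Proof.
move=> cmp; have /complement_mxcol/complement_tr c i := complement_tr (cmp i).
move: c; rewrite !tr_dsum !tr_mxcol !trmxK.
have E m (n_' : 'I_t -> nat) T (D : forall i, 'M[T]_(m, n_' i)) :
    \mxrow_i ((D i)^T)^T = \mxrow_i D i by apply: eq_mxrow => i; rewrite trmxK.
have F (D : forall i, 'M[K]_(m_ i, n_ i)) :
    dsum 0 (fun i => ((D i)^T)^T) = dsum 0 D.
  by apply: eq_mxblock => i j; rewrite trmxK.
by rewrite !E !F.
Qed.

Lemma complement_mxblock t t' (m_ n_ : 'I_t -> nat) (m_' n_' : 'I_t' -> nat)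
    (A1 B1 : forall i, 'M[K]_(m_ i, n_ i)) (A2 B2 : forall i, 'M[K]_(m_' i, n_' i))
    SP SQ :
  (forall i j, complement (A1 i) (B1 i) (A2 j) (B2 j) (SP i j) (SQ i j)) ->
  complement (dsum 0 A1) (dsum 0 B1) (dsum 0 A2) (dsum 0 B2)
    (\mxblock_(i, j) SP i j) (\mxblock_(i, j) SQ i j).
Proof.
move=> cmp; rewrite !mxblockEv; apply: complement_mxcol => i.
by apply: complement_mxrow => j.
Qed.

End Complement.

(** * Nilpotent matrices and the equation [s - C s N = c] *)

Section Stein.
Variable K : fieldType.

(** Nilpotency is expressed by a grading of the indices that the matrix strictly
    raises: this form is preserved by renumbering and by diagonal sums, and an
    induction over the grading replaces a computation with powers. *)
Definition graded_nilpotent (n : nat) (N : 'M[K]_n) :=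
  exists g : 'I_n -> nat, forall i j, N i j != 0 -> (g i < g j)%N.

Lemma graded_nilpotent_tr n (N : 'M[K]_n) :
  graded_nilpotent N -> graded_nilpotent N^T.
Proof.
case=> g gP; exists (fun i => (\max_k g k).+1 - g i)%N => i j; rewrite mxE.
by move/gP => ltji; have := leq_bigmax (F := g) i; lia.
Qed.

Lemma graded_nilpotent_mxsub n n' (N : 'M[K]_n) (f : 'I_n' -> 'I_n) :
  graded_nilpotent N -> graded_nilpotent (mxsub f f N).
Proof. by case=> g gP; exists (g \o f) => i j; rewrite mxE => /gP. Qed.

Lemma graded_nilpotent_mxdiag t (n_ : 'I_t -> nat) (N : forall i, 'M[K]_(n_ i)) :
  (forall i, graded_nilpotent (N i)) -> graded_nilpotent (\mxdiag_i N i).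
Proof.
move=> /(_ _)/cid-/all_sig[g gP].
exists (fun x => g (tagnat.sig1 x) (tagnat.sig2 x)) => x y; rewrite mxE.
move: (tagnat.sig2 x) (tagnat.sig2 y); move: (tagnat.sig1 x) (tagnat.sig1 y).
move=> i j; case: eqP => [<- a b|_ a b]; last by rewrite mxE eqxx.
by rewrite conform_mx_id => /gP.
Qed.

Lemma linear_inj_surj m n (f : 'M[K]_(m, n) -> 'M[K]_(m, n)) :
  linear f -> (forall s, f s = 0 -> s = 0) -> forall c, exists s, f s = c.
Proof.
move=> fL f0 c.
pose fM := GRing.isLinear.Build _ _ _ _ f fL.
pose F : {linear 'M[K]_(m, n) -> 'M[K]_(m, n)} := HB.pack f fM.
have uF : lin_mx F \in unitmx.
  rewrite -row_free_unit -kermx_eq0; apply/rowV0P => v /sub_kermxP.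
  rewrite -[v]vec_mxK mul_vec_lin => /(canRL mxvecK); rewrite raddf0.
  by move/f0 => ->; rewrite raddf0.
exists (vec_mx (mxvec c *m invmx (lin_mx F))).
rewrite -[f _](mxvecK) -[mxvec _](mul_vec_lin F) vec_mxK.
by rewrite mulmxKV ?mxvecK.
Qed.

(** Column [j] of [C s N] only involves columns of [s] of smaller grade. *)
Lemma stein_inj m n (C : 'M[K]_m) (N : 'M[K]_n) (s : 'M[K]_(m, n)) :
  graded_nilpotent N -> s = C *m s *m N -> s = 0.
Proof.
case=> g gP sE.
suff s0 k i j : (g j < k)%N -> s i j = 0.
  by apply/matrixP=> i j; rewrite mxE (s0 (g j).+1).
elim: k i j => // k IHk i j; rewrite ltnS => gk.
rewrite sE mxE big1 // => z _; have [->|/gP gz] := eqVneq (N z j) 0.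
  by rewrite mulr0.
by rewrite mxE big1 ?mul0r // => w _; rewrite IHk ?mulr0 // (leq_trans gz).
Qed.

(** Uniqueness gives existence, the spaces of [s] and of [c] being the same. *)
Lemma steinr m n (C : 'M[K]_m) (N : 'M[K]_n) (c : 'M[K]_(m, n)) :
  graded_nilpotent N -> exists s, s - C *m s *m N = c.
Proof.
move=> gN; apply: (@linear_inj_surj _ _ (fun s => s - C *m s *m N)).
  move=> a u v; rewrite mulmxDr mulmxDl -scalemxAr -scalemxAl scalerBr.
  by rewrite opprD addrACA.
by move=> s /eqP; rewrite subr_eq0 => /eqP; apply: stein_inj.
Qed.

Lemma steinl m n (N : 'M[K]_m) (C : 'M[K]_n) (c : 'M[K]_(m, n)) :
  graded_nilpotent N -> exists s, s - N *m s *m C = c.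
Proof.
move/graded_nilpotent_tr => /(steinr C^T c^T)[s sE]; exists s^T.
by apply: trmx_inj; rewrite -sE raddfB /= !trmx_mul trmxK mulmxA.
Qed.

(** If both matrices are nilpotent up to scalars [a1] and [a2], induction over
    the gradings shows that the kernel of the Sylvester operator is trivial. *)
Lemma sylvester_surj m n a1 a2 (N1 : 'M[K]_m) (N2 : 'M[K]_n) (c : 'M[K]_(m, n)) :
  a1 != a2 -> graded_nilpotent N1 -> graded_nilpotent N2 ->
  exists s, s *m (a2%:M + N2) - (a1%:M + N1) *m s = c.
Proof.
move=> a12 /graded_nilpotent_tr[g1 g1P] [g2 g2P].
apply: (@linear_inj_surj _ _ (fun s => s *m (a2%:M + N2) - (a1%:M + N1) *m s)).
  move: (a1%:M + N1) (a2%:M + N2) => C1 C2 a u v.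
  by rewrite mulmxDl mulmxDr -scalemxAr -scalemxAl scalerBr opprD addrACA.
move=> s; rewrite mulmxDl mulmxDr mul_mx_scalar mul_scalar_mx => sE.
suff s0 k i j : (g1 i + g2 j < k)%N -> s i j = 0.
  by apply/matrixP=> i j; rewrite mxE (s0 (g1 i + g2 j).+1)%N.
elim: k i j => // k IHk i j; rewrite ltnS => gk.
have /matrixP/(_ i j) := sE; rewrite !mxE.
rewrite big1 ?addr0 => [|z _]; last first.
  have [->|/g2P gz] := eqVneq (N2 z j) 0; first by rewrite mulr0.
  by rewrite IHk ?mul0r // (leq_trans _ gk) // ltn_add2l.
rewrite big1 ?addr0 => [|z _]; last first.
  have [->|] := eqVneq (N1 i z) 0; first by rewrite mul0r.
  move=> nz; have gz : (g1 z < g1 i)%N by apply: g1P; rewrite mxE.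
  by rewrite IHk ?mulr0 // (leq_trans _ gk) // ltn_add2r.
move/eqP; rewrite -mulrBl mulf_eq0 subr_eq0 eq_sym (negPf a12) => /eqP.
by [].
Qed.

End Stein.

(** * Entries of matrices at natural positions *)

Section Entry.
Variable K : fieldType.

(** Extending a matrix by zeros turns the products with [F_mx] and [G_mx] into
    plain shifts of the positions. *)
Definition entry (m n : nat) (M : 'M[K]_(m, n)) (i j : nat) : K :=
  if insub i is Some i' then if insub j is Some j' then M i' j' else 0 else 0.

Lemma entry_ord m n (M : 'M[K]_(m, n)) (i : 'I_m) (j : 'I_n) :
  entry M i j = M i j.
Proof. by rewrite /entry !valK. Qed.

Lemma entry_out m n (M : 'M[K]_(m, n)) i j :
  (m <= i)%N || (n <= j)%N -> entry M i j = 0.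
Proof.
by rewrite /entry; case/orP => ?; [|case: insubP => // ? _ _];
  rewrite insubF // ltnNge; apply/negbTE; rewrite negbK.
Qed.

Lemma entry_eq m n (M : 'M[K]_(m, n)) (f : nat -> nat -> K) :
  (forall (i : 'I_m) (j : 'I_n), M i j = f i j) ->
  (forall i j, (m <= i)%N || (n <= j)%N -> f i j = 0) ->
  forall i j, entry M i j = f i j.
Proof.
move=> Mf f0 i j; case: (ltnP i m) => im; last by rewrite entry_out ?f0 ?im.
case: (ltnP j n) => jn; last by rewrite entry_out ?f0 ?jn ?orbT.
by rewrite -[ i ]/(val (Ordinal im)) -[j]/(val (Ordinal jn)) entry_ord Mf.
Qed.

Lemma entry_mx m n (f : nat -> nat -> K) i j : (i < m)%N -> (j < n)%N ->
  entry (\matrix_(a < m, b < n) f a b) i j = f i j.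
Proof.
by move=> im jn; rewrite -[ i ]/(val (Ordinal im)) -[j]/(val (Ordinal jn))
  entry_ord mxE.
Qed.

Lemma entry_tr m n (M : 'M[K]_(m, n)) i j : entry M^T i j = entry M j i.
Proof.
by rewrite /entry; case: insubP => [j' _ _|_]; case: insubP => [i' _ _|_];
  rewrite ?mxE.
Qed.

Lemma entryB m n (M N : 'M[K]_(m, n)) i j :
  entry (M - N) i j = entry M i j - entry N i j.
Proof.
by rewrite /entry; case: insubP => [j' _ _|_]; [case: insubP => [i' _ _|_]|];
  rewrite ?mxE ?subr0.
Qed.

(** Every entry of [F_mx] and [G_mx] is such a Kronecker symbol. *)
Lemma sum_entry m n (M : 'M[K]_(m, n)) (i : 'I_m) a :
  \sum_k M i k * (k == a :> nat)%:R = entry M i a.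
Proof.
case: (ltnP a n) => an; last first.
  rewrite entry_out ?an ?orbT // big1 // => k _.
  by rewrite (ltn_eqF (leq_trans (ltn_ord k) an)) mulr0.
rewrite -[a]/(val (Ordinal an)) entry_ord (bigD1 (Ordinal an)) //= eqxx mulr1.
by rewrite big1 ?addr0 // => k /negPf; rewrite -val_eqE /= => ->; rewrite mulr0.
Qed.

Lemma entry_mulF m p (c : 'M[K]_(m, p)) i j :
  entry (c *m F_mx K p) i j = if (j < p.-1)%N then entry c i j else 0.
Proof.
apply: (@entry_eq _ _ _ (fun i j => if (j < p.-1)%N then entry c i j else 0));
  clear i j => i j.
  rewrite ltn_ord -sum_entry mxE; apply: eq_bigr => k _; rewrite mxE.
  by case: eqP => // ->; rewrite ltn_ord.
by case: (ltnP j) => // jp; case: (ltnP i m) => im; rewrite ?orbF ?orbT // => _;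
  rewrite entry_out ?im.
Qed.

Lemma entry_mulG m p (c : 'M[K]_(m, p)) i j :
  entry (c *m G_mx K p) i j = if (j < p.-1)%N then entry c i j.+1 else 0.
Proof.
apply: (@entry_eq _ _ _ (fun i j => if (j < p.-1)%N then entry c i j.+1 else 0));
  clear i j => i j.
  by rewrite ltn_ord -sum_entry mxE; apply: eq_bigr => k _; rewrite mxE.
by case: (ltnP j) => // jp; case: (ltnP i m) => im; rewrite ?orbF ?orbT // => _;
  rewrite entry_out ?im.
Qed.

Lemma entry_mulFT m p (c : 'M[K]_(m, p.-1)) i j :
  entry (c *m (F_mx K p)^T) i j = entry c i j.
Proof.
apply: entry_eq; clear i j => i j.
  rewrite -sum_entry mxE; apply: eq_bigr => k _; rewrite !mxE eq_sym.
  by case: eqP => //= <-; rewrite ltn_ord.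
by move=> o; rewrite entry_out //; move: o; case: (m <= i)%N => //=;
  apply/leq_trans/leq_pred.
Qed.

Lemma entry_mulGT m p (c : 'M[K]_(m, p.-1)) i j :
  entry (c *m (G_mx K p)^T) i j = if j is j'.+1 then entry c i j' else 0.
Proof.
apply: (@entry_eq _ _ _ (fun i j => if j is j'.+1 then entry c i j' else 0));
  clear i j => i j.
  rewrite mxE; case: j => [[|j] jp] /=.
    by rewrite big1 // => k _; rewrite !mxE mulr0.
  by rewrite -sum_entry; apply: eq_bigr => k _; rewrite !mxE /= eqSS eq_sym.
case: j => // j o; rewrite entry_out //; move: o; case: (m <= i)%N => //=.
by case: p c.
Qed.

Lemma entry_FTmul n p (c : 'M[K]_(p, n)) i j :
  entry ((F_mx K p)^T *m c) i j = if (i < p.-1)%N then entry c i j else 0.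
Proof. by rewrite -entry_tr trmx_mul trmxK entry_mulF entry_tr. Qed.

Lemma entry_GTmul n p (c : 'M[K]_(p, n)) i j :
  entry ((G_mx K p)^T *m c) i j = if (i < p.-1)%N then entry c i.+1 j else 0.
Proof. by rewrite -entry_tr trmx_mul trmxK entry_mulG entry_tr. Qed.

Lemma mulFTF p : (F_mx K p)^T *m F_mx K p = 1%:M.
Proof.
apply/matrixP=> i j; rewrite -entry_ord entry_FTmul ltn_ord !mxE.
rewrite /entry; case: insubP => [i' _ vi|]; last first.
  by rewrite (leq_trans (ltn_ord i) (leq_pred p)).
by rewrite valK mxE vi ltn_ord andbT.
Qed.

Lemma mulGTG p : (G_mx K p)^T *m G_mx K p = 1%:M.
Proof.
apply/matrixP=> i j; rewrite -entry_ord entry_GTmul ltn_ord !mxE.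
rewrite /entry; case: insubP => [i' _ vi|]; last first.
  by have := ltn_ord i; lia.
by rewrite valK mxE vi eqSS.
Qed.

Lemma graded_FTG p : graded_nilpotent ((F_mx K p)^T *m G_mx K p).
Proof.
exists (fun i => p - i)%N => i j; rewrite -entry_ord entry_FTmul ltn_ord.
rewrite /entry; case: insubP => [i' _ vi|]; last by rewrite eqxx.
rewrite valK mxE vi; case: (i =P j.+1 :> nat) => [ij _|];
  last by rewrite /= eqxx.
by have := ltn_ord i; lia.
Qed.

Lemma graded_GTF p : graded_nilpotent ((G_mx K p)^T *m F_mx K p).
Proof.
exists val => i j; rewrite -entry_ord entry_GTmul ltn_ord.
rewrite /entry; case: insubP => [i' _ vi|]; last by rewrite eqxx.
rewrite valK mxE vi; case: (i.+1 =P j :> nat) => [ij _|];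
  last by rewrite /= eqxx.
by rewrite /= -ij.
Qed.

Lemma supported_last_col m p (c : 'M[K]_(m, p)) :
  supported (last_col m p) c <-> c *m F_mx K p = 0.
Proof.
split=> [sc|cF i j].
  apply/matrixP=> i j; rewrite -entry_ord entry_mulF ltn_ord mxE.
  rewrite /entry valK; case: insubP => // j' _ vj; apply: sc.
  rewrite mxE vj; case: p c j j' vj => // p c j j' vj.
  by rewrite eqSS neq_ltn ltn_ord.
rewrite mxE; case: p c cF j => [c _ []//|p c cF j]; rewrite eqSS => jp.
have {}jp : (j < p)%N by rewrite ltn_neqAle jp -ltnS ltn_ord.
by have := entry_mulF c i j; rewrite cF /= jp entry_ord => <-;
  rewrite -[j : nat]/(val (Ordinal jp)) entry_ord mxE.
Qed.

Lemma supported_first_col m p (c : 'M[K]_(m, p)) :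
  supported (first_col m p) c <-> c *m G_mx K p = 0.
Proof.
split=> [sc|cG i j].
  apply/matrixP=> i j; rewrite -entry_ord entry_mulG ltn_ord mxE.
  rewrite /entry valK; case: insubP => // j' _ vj; apply: sc.
  by rewrite mxE vj.
rewrite mxE; case: p c cG j => [c _ []//|p c cG [[|j] jp]] //= _.
have := entry_mulG c i j; rewrite cG /= -ltnS jp -[j.+1]/(val (Ordinal jp)).
by rewrite entry_ord => <-;
  rewrite -[j]/(val (Ordinal (jp : j < p)%N)) entry_ord mxE.
Qed.

Lemma supported_first_row m p (c : 'M[K]_(p, m)) :
  supported (first_row p m) c <-> (G_mx K p)^T *m c = 0.
Proof.
have E : (first_row p m)^T = first_col m p by apply/matrixP=> i j; rewrite !mxE.
apply: (iff_trans (iff_sym (supported_tr _ _))); rewrite E.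
apply: (iff_trans (supported_first_col _)).
by rewrite -[in X in _ <-> X](trmxK c) -trmx_mul;
  split=> [->|/(canRL (@trmxK _ _ _))->];
  rewrite trmx0.
Qed.

End Entry.

(** * The blocks of a Kronecker canonical pair *)

Section Blocks.
Local Ltac mxring := apply/matrixP=> ? ?; rewrite !mxE; ring.
Variable K : fieldType.
Local Notation F := (F_mx K).
Local Notation G := (G_mx K).
Local Notation O := (no_stars _ _).

Lemma complement_onto m1 n1 m2 n2 (A1 B1 : 'M[K]_(m1, n1)) (A2 B2 : 'M[K]_(m2, n2)) :
  (forall M N, exists s x, s *m A2 - A1 *m x = M /\ s *m B2 - B1 *m x = N) ->
  complement A1 B1 A2 B2 O O.
Proof.
move=> ex; split=> [M N|s x].
  have [s [x [<- <-]]] := ex M N; exists s, x.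
  by rewrite !subrr; split; apply: supported0.
by move=> /supported_no_stars/subr0_eq-> /supported_no_stars/subr0_eq->.
Qed.

(** With [A1 = A2 = 1%:M] the first equation determines [x], and the second one
    becomes the equation of deformations under similarity. *)
Lemma complement_similarity m n (C1 : 'M[K]_m) (C2 : 'M[K]_n) S :
  (forall c, exists s, supported S (c - (s *m C2 - C1 *m s))) ->
  (forall s, supported S (s *m C2 - C1 *m s) -> s *m C2 = C1 *m s) ->
  complement 1%:M C1 1%:M C2 O S.
Proof.
move=> ex un; split=> [M N|s x].
  have [s sP] := ex (N - C1 *m M); exists s, (s - M).
  rewrite mulmx1 mul1mx; split.
    by apply/supported_no_stars; rewrite subKr subrr.
  rewrite [X in supported S X](_ : _ = N - C1 *m M - (s *m C2 - C1 *m s)) //.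
  by rewrite mulmxBr; mxring.
rewrite mulmx1 mul1mx => /supported_no_stars/subr0_eq <- /un ->.
by split.
Qed.

(** After the elimination of [x] the map is [s - C s N]: the finite eigenvalues
    of one pencil and the infinite eigenvalue of the other do not interact. *)
Lemma complement_finite_infinite m n (C : 'M[K]_m) (N : 'M[K]_n) :
  graded_nilpotent N -> complement 1%:M C N 1%:M O O.
Proof.
move=> gN; apply: complement_onto => M M'.
have [s sE] := steinr C (M' - C *m M) gN; exists s, (s *m N - M).
rewrite mulmx1 mul1mx; split; first by rewrite opprB addrC subrK.
by rewrite mulmxBr mulmxA opprB addrCA sE addrC subrK.
Qed.

(** Looking for [x] of the form [G w] suffices: since [G^T G = 1], the only
    equation left is [w - (F^T G) w C = c]. *)
Lemma complement_L_finite p n (C : 'M[K]_n) :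
  complement (F p)^T (G p)^T 1%:M C O O.
Proof.
apply: complement_onto => M N.
have [w wE] := steinl C (M *m C - N) (graded_FTG K p).
exists (M + (F p)^T *m (G p *m w)), (G p *m w).
rewrite mulmx1 addrK mulmxDl [(G p)^T *m _]mulmxA mulGTG mul1mx -addrA.
split=> //; rewrite [_ *m C - w](_ : _ = N - M *m C);
  first by rewrite addrC subrK.
by rewrite -[RHS]opprB -wE opprB !mulmxA.
Qed.

(** The same argument with the shifts [F] and [G] exchanged. *)
Lemma complement_L_infinite p n (C : 'M[K]_n) :
  complement (F p)^T (G p)^T C 1%:M O O.
Proof.
apply: complement_onto => M N.
have [w wE] := steinl C (N *m C - M) (graded_GTF K p).
exists (N + (G p)^T *m (F p *m w)), (F p *m w).
rewrite mulmx1 addrK mulmxDl [(F p)^T *m _]mulmxA mulFTF mul1mx -addrA.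
split=> //; rewrite [_ *m C - w](_ : _ = M - N *m C);
  first by rewrite addrC subrK.
by rewrite -[RHS]opprB -wE opprB !mulmxA.
Qed.

(** Multiplying the second equation by [G p] deletes its first column; what is
    left is an equation [s - C s N = c] with [N] nilpotent. *)
Lemma complement_finite_L n (C : 'M[K]_n) p :
  complement 1%:M C (F p)^T (G p)^T O (first_col n p).
Proof.
have gr := graded_FTG K p; split=> [M N|s x].
  have [s sE] := steinr C ((N - C *m M) *m G p) gr.
  exists s, (s *m (F p)^T - M); rewrite mul1mx; split.
    by apply/supported_no_stars; rewrite subKr subrr.
  apply/supported_first_col.
  rewrite (_ : _ - _ = N - C *m M - (s *m (G p)^T - C *m s *m (F p)^T)).
    by rewrite mulmxBl -sE mulmxBl -!mulmxA mulGTG mulmx1 subrr.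
  by rewrite mulmxBr !mulmxA; mxring.
rewrite mul1mx => /supported_no_stars/subr0_eq <- /supported_first_col.
rewrite mulmxBl -!mulmxA mulGTG mulmx1 => /subr0_eq;
  rewrite !mulmxA -[C *m s *m _ *m _]mulmxA.
by move=> /(stein_inj gr) ->; rewrite !mul0mx ?mulmx0 ?mul0mx.
Qed.

(** Here multiplication by [F p] deletes the last column of the first equation. *)
Lemma complement_infinite_L n (C : 'M[K]_n) p :
  complement C 1%:M (F p)^T (G p)^T (last_col n p) O.
Proof.
have gr := graded_GTF K p; split=> [M N|s x].
  have [s sE] := steinr C ((M - C *m N) *m F p) gr.
  exists s, (s *m (G p)^T - N); rewrite mul1mx; split; last first.
    by apply/supported_no_stars; rewrite subKr subrr.
  apply/supported_last_col.
  rewrite (_ : _ - _ = M - C *m N - (s *m (F p)^T - C *m s *m (G p)^T)).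
    by rewrite mulmxBl -sE mulmxBl -!mulmxA mulFTF mulmx1 subrr.
  by rewrite mulmxBr !mulmxA; mxring.
rewrite mul1mx => /[swap];
  move=> /supported_no_stars/subr0_eq <- /supported_last_col.
rewrite mulmxBl -!mulmxA mulFTF mulmx1 => /subr0_eq;
  rewrite !mulmxA -[C *m s *m _ *m _]mulmxA.
by move=> /(stein_inj gr) ->; rewrite !mul0mx ?mulmx0 ?mul0mx.
Qed.

(** With [s = w F^T] and [x = G u] the second equation determines [u], and the
    first one is of the form [w - N w N' = c]. *)
Lemma complement_L_R p q : complement (F p)^T (G p)^T (F q) (G q) O O.
Proof.
apply: complement_onto => M N.
have [w wE] := steinl ((F q)^T *m G q) (M - (F p)^T *m G p *m N) (graded_FTG K p).
exists (w *m (F q)^T), (G p *m (w *m (F q)^T *m G q - N)).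
rewrite -[w *m _ *m F q]mulmxA mulFTF mulmx1 [(G p)^T *m _]mulmxA mulGTG mul1mx.
rewrite subKr; split=> //.
rewrite (_ : w - _ = w - (F p)^T *m G p *m w *m ((F q)^T *m G q) +
                      (F p)^T *m G p *m N); first by rewrite wE subrK.
by rewrite !mulmxBr !mulmxA; mxring.
Qed.

(** Deleting the last column of the first equation and the first row of the second
    one leaves as many equations as unknowns: [x] is determined by the second one,
    and the first one becomes [s - C s N = c]. *)
Lemma complement_R_L q p :
  complement (F q) (G q) (F p)^T (G p)^T (last_col q p) (first_row q p).
Proof.
have gr := graded_GTF K p; split=> [M N|s x].
  have [s sE] := steinr (F q *m (G q)^T)
    (M *m F p - F q *m (G q)^T *m N *m F p) gr.
  exists s, ((G q)^T *m (s *m (G p)^T - N)); split.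
    apply/supported_last_col; rewrite !mulmxBl -!mulmxA mulFTF mulmx1.
    apply/eqP; rewrite subr_eq0 eq_sym; apply/eqP; move: sE.
    rewrite !(mulmxBl, mulmxBr) !mulmxA => sE.
    by rewrite opprB addrCA sE addrC subrK.
  apply/supported_first_row; set y := (G q)^T *m (_ - N).
  rewrite !mulmxBr [(G q)^T *m (G q *m _)]mulmxA mulGTG mul1mx.
  by rewrite /y mulmxBr subKr subrr.
move=> /supported_last_col + /supported_first_row.
rewrite mulmxBl mulmxBr -!mulmxA mulFTF mulmx1 [(G q)^T *m (G q *m _)]mulmxA mulGTG mul1mx.
move=> /subr0_eq sE /subr0_eq xE; move: sE; rewrite -xE !mulmxA.
rewrite -[_ *m _ *m s *m _ *m _]mulmxA => /(stein_inj gr) s0.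
by rewrite s0 !(mul0mx, mulmx0).
Qed.

(** Along every diagonal the unknowns [s a b] are linked by the equations
    [s a (b - 1) - s (a + 1) b = c a b]. This is an overdetermined system only
    on the diagonals that run from the first column to the last column; there
    are [p1 - p2 - 1] of them, and their equations in the first column are
    those of the stars. On these diagonals the equations are solved from the
    last column backwards, on those starting in other places of the first column
    from the first column onwards. *)
Lemma complement_L_L p1 p2 :
  complement (F p1)^T (G p1)^T (F p2)^T (G p2)^T O (Z_stars p2 p1.-1)^T.
Proof.
set u := p1.-1; set v := p2.-1.
have starE i j : (Z_stars p2 u)^T i j = (j == 0 :> nat) && (i < u - p2)%N.
  by rewrite !mxE.
split=> [M N|s x].
  (* The first equation gives all rows of x but the last one; inserting them
     in the second equation gives the right hand side c. The last row of x
     serves to solve the equations in the last row. *)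
  pose c a b := if (a.+1 < u)%N then entry N a b - entry M a.+1 b else 0.
  pose fix fwd (b a : nat) {struct b} : K :=
    if b is b'.+1 then fwd b' a.-1 - c a.-1 b else - c a.-1 0.
  (* bwd d a is the unknown in row a and column v - d - 1, obtained from the
     equations to the right of it. *)
  pose fix bwd (d a : nat) {struct d} : K :=
    c a (v - d)%N + (if d is d'.+1 then bwd d' a.+1 else 0).
  (* The diagonal through (a, b) leaves the first column in row a - b - 1; it is
     one of the overdetermined diagonals if a < b + (u - v). *)
  pose sf a b : K := if (a <= b)%N || (a < b + (u - v))%N then bwd (v - b.+1)%N a
                     else fwd b a.
  pose s := \matrix_(a < u, b < v) sf a b.
  pose xf a b : K := if (a < u)%N then entry s a b - entry M a b
    else (if b is b'.+1 then entry s u.-1 b' else 0) - entry N u.-1 b.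
  pose x := \matrix_(a < p1, b < p2) xf a b.
  exists s, x; split.
    apply/supported_no_stars/matrixP=> i j.
    rewrite -entry_ord [RHS]mxE !entryB entry_mulFT entry_FTmul -/u ltn_ord.
    rewrite [entry x _ _]entry_mx ?ltn_ord ?(leq_trans (ltn_ord i)) ?leq_pred //.
    by rewrite /xf ltn_ord subKr subrr.
  move=> i j; rewrite starE => ns.
  rewrite -entry_ord !entryB entry_mulGT entry_GTmul -/u ltn_ord.
  have iu := ltn_ord i; have jp := ltn_ord j.
  rewrite [entry x _ _]entry_mx //; last by move: iu; rewrite /u; lia.
  rewrite /xf; case: ltnP => iu'; last first.
    have -> : u.-1 = i by lia.
    by rewrite subKr subrr.
  have cE : c i j = entry N i j - entry M i.+1 j by rewrite /c iu'.
  have tail a b : (v <= b)%N -> entry s a b = 0.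
    by move=> vb; rewrite entry_out ?vb ?orbT.
  suff -> : (if nat_of_ord j is j'.+1 then entry s i j' else 0) =
            entry s i.+1 j + c i j.
    by rewrite cE; ring.
  case: (nat_of_ord j) jp ns {cE} => [|b] jp ns.
    have [v0|v0] := posnP v; first by exfalso; move: ns v0; rewrite /= /v; lia.
    rewrite [entry s _ _]entry_mx // /sf.
    rewrite ifF /=; first by rewrite addNr.
    by apply/negbTE; move: ns; rewrite /= /v; lia.
  have bv : (b < v)%N by rewrite /v; lia.
  rewrite [entry s i b]entry_mx //.
  have [bv'|vb] := ltnP b.+1 v.
    rewrite [entry s i.+1 b.+1]entry_mx // /sf ltnS addSn ltnS.
    case: ifP => _; last by rewrite /= subrK.
    have -> : (v - b.+1 = (v - b.+2).+1)%N by lia.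
    rewrite /= addrC; congr (_ + c _ _); lia.
  rewrite tail // add0r /sf ifT; last by rewrite /v; lia.
  have -> : (v - b.+1 = 0)%N by lia.
  by rewrite /= addr0; congr (c _ _); lia.
move=> /supported_no_stars/subr0_eq sE sQ; split=> //; apply: subr0_eq.
have xE a b : (a < u)%N -> entry x a b = entry s a b.
  by move=> au; rewrite -(entry_mulFT s) sE entry_FTmul au.
have eqs a b : (a.+1 < u)%N -> (b < p2)%N ->
    entry (s *m (G p2)^T - (G p1)^T *m x) a b =
    (if b is b'.+1 then entry s a b' else 0) - entry s a.+1 b.
  by move=> au bp; rewrite entryB entry_mulGT entry_GTmul -/u (ltnW au) xE.
have vanish a b : (a < u)%N -> (b < p2)%N -> ~~ ((b == 0) && (a < u - p2))%N ->
    entry (s *m (G p2)^T - (G p1)^T *m x) a b = 0.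
  move=> au bp ns; rewrite -[ a ]/(val (Ordinal au)) -[ b ]/(val (Ordinal bp)).
  by rewrite entry_ord sQ // starE.
have s0 d a b : (v - b = d)%N -> (a + d < u)%N -> entry s a b = 0.
  elim: d a b => [|d IHd] a b vb ad; first by rewrite entry_out // -/v; lia.
  have b2 : (b.+1 < p2)%N by move: vb; rewrite /v; lia.
  have := vanish a b.+1; rewrite eqs ?(IHd a.+1 b.+1) ?subr0; try lia.
  by apply=> //; lia.
apply/matrixP=> i j; rewrite -entry_ord mxE.
case: (boolP ((j == 0 :> nat) && (i < u - p2)%N)) => [/andP[/eqP j0 iu]|ns].
  have jp := ltn_ord j; rewrite eqs //; last by lia.
  by rewrite j0 (s0 v) ?subr0 // /v; lia.
by rewrite vanish ?ltn_ord.
Qed.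

(** The equations are again [s a (b - 1) - s (a + 1) b = c a b], now with all
    unknowns outside of the matrix equal to zero. The overdetermined diagonals
    are those from the first column to the last row; a star may be put at
    either end of them. *)
Lemma complement_jordan_block (lam : K) p q :
  complement 1%:M (jordan_block lam p) 1%:M (jordan_block lam q) O
    (T_stars p q).
Proof.
have eqs (s : 'M[K]_(p, q)) a b : (a < p)%N -> (b < q)%N ->
    entry (s *m jordan_block lam q - jordan_block lam p *m s) a b =
    (if b is b'.+1 then entry s a b' else 0) - entry s a.+1 b.
  move=> ap bq; rewrite -[ a ]/(val (Ordinal ap)) -[ b ]/(val (Ordinal bq)).
  rewrite entry_ord !mxE.
  have -> : \sum_k s (Ordinal ap) k * jordan_block lam q k (Ordinal bq) =
      lam * entry s a b + if b is b'.+1 then entry s a b' else 0.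
    under eq_bigr => k _ do rewrite mxE mulrDr -[lam *+ _]mulr_natr mulrCA.
    rewrite big_split -mulr_sumr /=; congr (_ * _ + _).
      exact: (sum_entry s (Ordinal ap)).
    case: b bq => [|b] bq.
      by rewrite big1 // => k _; rewrite mulr0.
    rewrite -(sum_entry s (Ordinal ap)); apply: eq_bigr => k _.
    by rewrite /= eqSS eq_sym.
  have -> : \sum_k jordan_block lam p (Ordinal ap) k * s k (Ordinal bq) =
      lam * entry s a b + entry s a.+1 b.
    under eq_bigr => k _ do rewrite mxE mulrDl -[lam *+ _]mulr_natr -mulrA.
    rewrite big_split -mulr_sumr /=; congr (_ * _ + _).
      rewrite -entry_tr -(sum_entry s^T (Ordinal bq)).
      by apply: eq_bigr => k _; rewrite mxE mulrC eq_sym.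
    rewrite -entry_tr -(sum_entry s^T (Ordinal bq)).
    by apply: eq_bigr => k _; rewrite mxE mulrC.
  by rewrite opprD addrACA subrr add0r.
apply: complement_similarity => [c|s sS].
  have [pq|qp] := ltnP p q; last first.
    (* Stars in the last row: the equations are solved downwards from zero. *)
    pose fix sf (a b : nat) {struct a} : K := if a is a'.+1 then
      (if b is b'.+1 then sf a' b' else 0) - entry c a' b else 0.
    pose s := \matrix_(a < p, b < q) sf a b.
    exists s => i j; rewrite mxE ltnNge qp /= => ip.
    have {}ip : (i.+1 < p)%N by have := ltn_ord i; lia.
    rewrite -entry_ord entryB eqs // [entry s i.+1 j]entry_mx //=.
    suff -> : (if nat_of_ord j is b'.+1 then entry s i b' else 0) =
              if nat_of_ord j is b'.+1 then sf i b' else 0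
                by rewrite subKr subrr.
    case: (nat_of_ord j) (ltn_ord j) => // b bq.
    by rewrite entry_mx //; lia.
  (* Stars in the first column: the equations are solved backwards from the last
     column; bwd d a is the unknown in row a and column q - d - 1. *)
  pose fix bwd (d a : nat) {struct d} : K := if d is d'.+1 then
    entry c a (q - d)%N + bwd d' a.+1 else 0.
  have bwd0 d a : (p <= a)%N -> bwd d a = 0.
    elim: d a => //= d IHd a pa;
      rewrite IHd ?(leq_trans pa) // entry_out ?pa //.
    by rewrite addr0.
  pose s := \matrix_(a < p, b < q) bwd (q - b.+1)%N a.
  have sE a b : (b < q)%N -> entry s a b = bwd (q - b.+1)%N a.
    move=> bq; have [ap|pa] := ltnP a p; first exact:
      (@entry_mx K _ _ (fun a b => bwd (q - b.+1)%N a)).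
    by rewrite entry_out ?pa // bwd0.
  exists s => i j; rewrite mxE pq => j0.
  rewrite -entry_ord entryB eqs //;
    case: (nat_of_ord j) (ltn_ord j) j0 => // b bq _.
  rewrite !sE ?(ltnW bq) //; have -> : (q - b.+1 = (q - b.+2).+1)%N by lia.
  rewrite /= addrK (_ : (q - _ = b.+1)%N) ?subrr //; lia.
apply: subr0_eq; apply/matrixP=> i j; rewrite -entry_ord [RHS]mxE.
have vanish a b : (a < p)%N -> (b < q)%N ->
    ~~ (if (p < q)%N then b == 0 else a.+1 == p) ->
    (if b is b'.+1 then entry s a b' else 0) = entry s a.+1 b.
  move=> ap bq ns; apply: subr0_eq; rewrite -eqs //.
  rewrite -[ a ]/(val (Ordinal ap)) -[ b ]/(val (Ordinal bq)) entry_ord sS //.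
  by rewrite mxE.
rewrite eqs //; have ip := ltn_ord i; have jq := ltn_ord j.
have [pq|qp] := ltnP p q.
  have s0 d a b : (p - a = d)%N -> (b + d < q)%N -> entry s a b = 0.
    elim: d a b => [|d IHd] a b pa bd; first by rewrite entry_out //; lia.
    by rewrite (@vanish a b.+1) ?pq ?IHd //; lia.
  case: (nat_of_ord j) jq => [|b] bq.
    by rewrite (s0 (p - i.+1)%N) ?subrr //; lia.
  by rewrite (@vanish i b.+1) ?pq ?subrr.
have s0 b a : (b < a)%N -> entry s a b = 0.
  move=> ba; have [ap|pa] := ltnP a p; last by rewrite entry_out ?pa.
  have [bq|qb] := ltnP b q; last by rewrite entry_out ?qb ?orbT.
  have vb a' b' : (a'.+1 < p)%N -> (b' < q)%N ->
      (if b' is b''.+1 then entry s a' b'' else 0) = entry s a'.+1 b'.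
    by move=> a'p b'q; rewrite vanish // ?(ltnW a'p) // ltnNge qp /=; lia.
  elim: b a ba ap bq => [|b IHb] [//|a] ba ap bq; rewrite -vb // IHb //.
    exact: ltnW ap.
  exact: ltnW bq.
have [ip'|] := boolP (i.+1 == p).
  rewrite [entry s i.+1 _]entry_out ?subr0; last by rewrite (eqP ip') leqnn.
  by case: (nat_of_ord j) jq => // b bq; rewrite s0 //; lia.
by move=> ni; rewrite vanish ?subrr // ltnNge qp.
Qed.

End Blocks.

(** * Weyr matrices and the whole pair *)

Section Assembly.
Variable K : fieldType.

Lemma eq_complement m1 n1 m2 n2 (A1 B1 A1' B1' : 'M[K]_(m1, n1))
    (A2 B2 A2' B2' : 'M[K]_(m2, n2)) SP SQ SP' SQ' :
  A1 = A1' -> B1 = B1' -> A2 = A2' -> B2 = B2' -> SP = SP' -> SQ = SQ' ->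
  complement A1 B1 A2 B2 SP SQ -> complement A1' B1' A2' B2' SP' SQ'.
Proof. by move=> <- <- <- <- <- <-. Qed.

Lemma mxdiag_dsum t (m_ : 'I_t -> nat) (M : forall i, 'M[K]_(m_ i)) :
  \mxdiag_i M i = dsum 0 M.
Proof. by []. Qed.

Lemma dsum1 t (m_ : 'I_t -> nat) :
  dsum 0 (fun i => 1%:M : 'M[K]_(m_ i)) = 1%:M.
Proof. by rewrite -mxdiag_dsum mxdiagZ. Qed.

Lemma mxblock_no_stars t t' (m_ : 'I_t -> nat) (n_ : 'I_t' -> nat) :
  \mxblock_(i, j) no_stars (m_ i) (n_ j) = no_stars _ _.
Proof. by apply/matrixP=> i j; rewrite !mxE. Qed.

Lemma mxrow_no_stars m t (n_ : 'I_t -> nat) :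
  \mxrow_i no_stars m (n_ i) = no_stars _ _.
Proof. by apply/matrixP=> i j; rewrite !mxE. Qed.

Lemma mxcol_no_stars n t (m_ : 'I_t -> nat) :
  \mxcol_i no_stars (m_ i) n = no_stars _ _.
Proof. by apply/matrixP=> i j; rewrite !mxE. Qed.

Lemma complement_jordan_mx (lam : K) t (ns : 'I_t -> nat) :
  complement 1%:M (jordan_mx lam ns) 1%:M (jordan_mx lam ns)
    (no_stars _ _) (H_stars ns).
Proof.
apply: eq_complement (complement_mxblock
  (fun i j => complement_jordan_block lam (ns i) (ns j))); rewrite ?dsum1 //.
exact: mxblock_no_stars.
Qed.

Lemma size_weyr_order t (ns : 'I_t -> nat) : size (weyr_order ns) = (\sum_i ns i)%N.
Proof. by rewrite size_sort size_enum_ord. Qed.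

Lemma weyr_index_inj t (ns : 'I_t -> nat) : injective (@weyr_index t ns).
Proof.
move=> x y; rewrite /weyr_index.
rewrite (set_nth_default y) ?size_weyr_order ?ltn_ord // => /eqP.
rewrite nth_uniq ?size_weyr_order ?ltn_ord // ?sort_uniq ?enum_uniq //.
by move/eqP/val_inj.
Qed.

Lemma weyr_index_bij t (ns : 'I_t -> nat) : bijective (@weyr_index t ns).
Proof. exact/injF_bij/weyr_index_inj. Qed.

Lemma mxsub_scalar n n' (f : 'I_n' -> 'I_n) (a : K) :
  injective f -> mxsub f f a%:M = a%:M.
Proof. by move=> fI; apply/matrixP=> i j; rewrite !mxE (inj_eq fI). Qed.

Lemma complement_weyr_mx (lam : K) t (ns : 'I_t -> nat) :
  complement 1%:M (weyr_mx lam ns) 1%:M (weyr_mx lam ns)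
    (no_stars _ _) (weyr_stars ns).
Proof.
have wb := weyr_index_bij ns.
have := complement_mxsub wb wb wb wb (complement_jordan_mx lam ns).
apply: eq_complement; rewrite ?mxsub_scalar //; try exact: weyr_index_inj.
by apply/matrixP=> i j; rewrite !mxE.
Qed.

Lemma weyr_mxE (lam : K) t (ns : 'I_t -> nat) :
  weyr_mx lam ns = lam%:M + weyr_mx 0 ns.
Proof.
rewrite -(mxsub_scalar _ (@weyr_index_inj t ns)) /weyr_mx /weyr_permute -raddfD.
rewrite /jordan_mx -mxdiagZ -mxdiagD /=; congr mxsub; apply: eq_mxdiag => i.
by apply/matrixP=> a b; rewrite !mxE mul0rn add0r.
Qed.

Lemma graded_weyr_mx0 t (ns : 'I_t -> nat) :
  graded_nilpotent (weyr_mx (0 : K) ns).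
Proof.
apply: graded_nilpotent_mxsub; apply: graded_nilpotent_mxdiag => i.
exists val => a b; rewrite mxE mul0rn add0r.
by case: (nat_of_ord b =P a.+1) => [/= ->|]; rewrite ?eqxx.
Qed.

(** Blocks of different eigenvalues need no stars, the Sylvester operator being
    onto; the stars of equal eigenvalues are those of [complement_weyr_mx]. *)
Lemma complement_weyr_sum tau (lam : 'I_tau -> K) (t : 'I_tau -> nat)
    (nJ : forall c : 'I_tau, 'I_(t c) -> nat) :
  injective lam ->
  let J := \mxdiag_(c < tau) weyr_mx (lam c) (@nJ c) in
  complement 1%:M J 1%:M J (no_stars _ _)
    (dsum false (fun c => weyr_stars (@nJ c))).
Proof.
move=> lamI J.
have cmp c d : complement 1%:M (weyr_mx (lam c) (@nJ c)) 1%:M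
    (weyr_mx (lam d) (@nJ d)) (no_stars _ _)
    (if c == d then conform_mx (no_stars _ _) (weyr_stars (@nJ c))
     else no_stars _ _).
  case: eqVneq => [<-|cd]; first by rewrite conform_mx_id;
    apply: complement_weyr_mx.
  apply: complement_similarity => [c'|s /supported_no_stars/subr0_eq //].
  have /(sylvester_surj c') : lam c != lam d by rewrite (inj_eq lamI).
  move=> /(_ _ _ (graded_weyr_mx0 (@nJ c)) (graded_weyr_mx0 (@nJ d))).
  by rewrite -!weyr_mxE => -[s <-]; exists s; rewrite subrr; apply: supported0.
apply: eq_complement (complement_mxblock cmp); rewrite ?dsum1 //.
exact: mxblock_no_stars.
Qed.

Lemma block4_diag m1 m2 m3 m4 n1 n2 n3 n4 (A1 : 'M[K]_(m1, n1))
    (A2 : 'M[K]_(m2, n2)) (A3 : 'M[K]_(m3, n3)) (A4 : 'M[K]_(m4, n4)) :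
  block4 A1 0 0 0 0 A2 0 0 0 0 A3 0 0 0 0 A4 =
  block_mx A1 0 0 (block_mx A2 0 0 (block_mx A3 0 0 A4)).
Proof.
have E m m' n k (X : 'M[K]_(m, n)) (X' : 'M[K]_(m', n)) :
    col_mx (row_mx (0 : 'M[K]_(m, k)) X) (row_mx 0 X') = row_mx 0 (col_mx X X').
  by rewrite -[LHS]/(block_mx 0 X 0 X') block_mxEh col_mx0.
by rewrite /block4 !row_mx0 !E.
Qed.

(** The sixteen combinations of kinds of summands. The monotonicity of [p] and [q]
    makes the patterns Z empty on and above the diagonal. *)
Lemma complement_canon (l r : nat) (p : 'I_l -> nat) (q : 'I_r -> nat) n n'
    (J : 'M[K]_n) (J0 : 'M[K]_n') SK SH :
  (forall i j : 'I_l, (i <= j)%N -> (p i <= p j)%N) ->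
  (forall i j : 'I_r, (i <= j)%N -> (q j <= q i)%N) ->
  graded_nilpotent J0 ->
  complement 1%:M J 1%:M J (no_stars _ _) SK ->
  complement 1%:M J0 1%:M J0 (no_stars _ _) SH ->
  complement (canon_A p q n J0) (canon_B p q n' J)
    (canon_A p q n J0) (canon_B p q n' J)
    (stars_A p q n SH) (stars_B p q n' SK).
Proof.
move=> pM qM gJ0 cJ /complement_swap cJ0.
rewrite /canon_A /canon_B !block4_diag.
set LA := dsum 0 (fun i => (F_mx K (p i))^T).
set LB := dsum 0 (fun i => (G_mx K (p i))^T).
set RA := dsum 0 (fun i => F_mx K (q i)).
set RB := dsum 0 (fun i => G_mx K (q i)).
have tF k : F_mx K k = ((F_mx K k)^T)^T by rewrite trmxK.
have tG k : G_mx K k = ((G_mx K k)^T)^T by rewrite trmxK.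
have cLJ : complement LA LB 1%:M J (no_stars _ _) (no_stars _ _).
  rewrite -mxcol_no_stars; apply: complement_mxcol => i.
  exact: complement_L_finite.
have cLN : complement LA LB J0 1%:M (no_stars _ _) (no_stars _ _).
  rewrite -mxcol_no_stars; apply: complement_mxcol => i.
  exact: complement_L_infinite.
have cLR : complement LA LB RA RB (no_stars _ _) (no_stars _ _).
  rewrite -mxblock_no_stars; apply: complement_mxblock => i j.
  exact: complement_L_R.
have cLL : complement LA LB LA LB (no_stars _ _) (\mxblock_(i < l, j < l)
    if (j < i)%N then (Z_stars (p j) (p i).-1)^T else no_stars (p i).-1 (p j)).
  rewrite -mxblock_no_stars; apply: complement_mxblock => i j.
  apply: eq_complement (complement_L_L K (p i) (p j)) => //.
  case: ltnP => // /pM pij; apply/matrixP=> a b; rewrite !mxE.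
  by apply/negbTE; lia.
have cJL : complement 1%:M J LA LB (no_stars _ _)
    (\mxrow_(j < l) first_col n (p j)).
  rewrite -mxrow_no_stars; apply: complement_mxrow => i.
  exact: complement_finite_L.
have cNL : complement J0 1%:M LA LB (\mxrow_(j < l) last_col n' (p j))
    (no_stars _ _).
  rewrite -[no_stars _ _]mxrow_no_stars; apply: complement_mxrow => i.
  exact: complement_infinite_L.
have cJR : complement 1%:M J RA RB (no_stars _ _) (no_stars _ _).
  rewrite -mxrow_no_stars; apply: complement_mxrow => i.
  have := complement_tr (complement_L_finite (q i) J^T).
  by rewrite !trmxK trmx1; apply: eq_complement => //; apply/matrixP=> a b;
    rewrite !mxE.
have cNR : complement J0 1%:M RA RB (no_stars _ _) (no_stars _ _).
  rewrite -mxrow_no_stars; apply: complement_mxrow => i.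
  have := complement_tr (complement_L_infinite (q i) J0^T).
  by rewrite !trmxK trmx1; apply: eq_complement => //; apply/matrixP=> a b;
    rewrite !mxE.
have cRJ : complement RA RB 1%:M J (no_stars _ _)
    (\mxcol_(i < r) first_row (q i) n).
  rewrite -mxcol_no_stars; apply: complement_mxcol => i.
  have := complement_tr (complement_finite_L J^T (q i)).
  by rewrite !trmxK trmx1; apply: eq_complement => //; apply/matrixP=> a b;
    rewrite !mxE.
have cRN : complement RA RB J0 1%:M (\mxcol_(i < r) last_row (q i) n')
    (no_stars _ _).
  rewrite -[no_stars _ _]mxcol_no_stars; apply: complement_mxcol => i.
  have := complement_tr (complement_infinite_L J0^T (q i)).
  by rewrite !trmxK trmx1; apply: eq_complement => //; apply/matrixP=> a b;
    rewrite !mxE.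
have cRL : complement RA RB LA LB
    (\mxrow_(j < l) last_col (\sum_(i < r) q i) (p j))
    (\mxcol_(i < r) first_row (q i) (\sum_(j < l) p j)).
  have := complement_mxblock (fun i j => complement_R_L K (q i) (p j)).
  by apply: eq_complement => //; apply/matrixP=> a b; rewrite !mxE.
have cRR : complement RA RB RA RB (no_stars _ _) (\mxblock_(i < r, j < r)
    if (j < i)%N then Z_stars (q i) (q j).-1 else no_stars (q i) (q j).-1).
  rewrite -mxblock_no_stars; apply: complement_mxblock => i j.
  have := complement_tr (complement_L_L K (q j) (q i)); rewrite !trmxK.
  apply: eq_complement => //; first by apply/matrixP=> a b; rewrite !mxE.
  case: ltnP => // /qM qij; apply/matrixP=> a b; rewrite !mxE.
  by apply/negbTE; lia.
have cJN : complement 1%:M J J0 1%:M (no_stars _ _) (no_stars _ _).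
  exact: complement_finite_infinite.
have cNJ : complement J0 1%:M 1%:M J (no_stars _ _) (no_stars _ _).
  have := complement_tr (complement_finite_infinite J^T (graded_nilpotent_tr gJ0)).
  by rewrite !trmxK !trmx1; apply: eq_complement => //;
    apply/matrixP=> a b; rewrite !mxE.
rewrite /stars_A /stars_B /block4.
apply: complement_col; last apply: complement_col; last apply: complement_col;
  by apply: complement_row; last apply: complement_row;
    last apply: complement_row.
Qed.

End Assembly.

(** * Real-valued norms and a contraction principle *)

Section RealNorm.
Variable R : realType.
Local Notation C := (Cplx R).

(** The norms of complex normed modules take their values in the complex
    numbers; taking real parts makes real arithmetic available. *)
Definition rnorm (V : normedModType C) (x : V) : R := complex.Re `|x|.

Lemma rnormE (V : normedModType C) (x : V) : `|x| = (rnorm x)%:C :> R[i].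
Proof. by rewrite /rnorm RRe_real // normr_real. Qed.

Lemma le_normC (V W : normedModType C) (x : V) (y : W) :
  (`|x| <= `|y| :> C) = (rnorm x <= rnorm y).
Proof. by rewrite -lecR -!rnormE. Qed.

Lemma rnorm_ge0 (V : normedModType C) (x : V) : 0 <= rnorm x.
Proof. by rewrite -lecR -rnormE normr_ge0. Qed.

Lemma rnorm0 (V : normedModType C) : rnorm (0 : V) = 0.
Proof. by rewrite /rnorm normr0. Qed.

Lemma rnorm_eq0 (V : normedModType C) (x : V) : rnorm x = 0 -> x = 0.
Proof. by move=> x0; apply/eqP; rewrite -normr_eq0 rnormE x0. Qed.

Lemma rnormD (V : normedModType C) (x y : V) : rnorm (x + y) <= rnorm x + rnorm y.
Proof. by rewrite -lecR rmorphD /= -!rnormE; apply: ler_normD. Qed.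

Lemma rnormN (V : normedModType C) (x : V) : rnorm (- x) = rnorm x.
Proof. by rewrite /rnorm normrN. Qed.

Lemma rdistC (V : normedModType C) (x y : V) : rnorm (x - y) = rnorm (y - x).
Proof. by rewrite /rnorm distrC. Qed.

Lemma rnorm_sum (V : normedModType C) (I : finType) (F : I -> V) :
  rnorm (\sum_i F i) <= \sum_i rnorm (F i).
Proof.
elim/big_ind2: _ => [|x1 y1 x2 y2 h1 h2|//]; first by rewrite rnorm0.
by rewrite (le_trans (rnormD _ _)) // lerD.
Qed.

Lemma rnormZ (V : normedModType C) (a : C) (x : V) :
  rnorm (a *: x) = rnorm (a : C^o) * rnorm x.
Proof.
apply: complexI; rewrite rmorphM /= -!rnormE normrZ.
by rewrite (rnormE (a : C^o)).
Qed.

Lemma near0P (V : normedModType C) (P : V -> Prop) :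
  (\forall x \near (0 : V), P x) <->
  exists2 d : R, 0 < d & forall x, rnorm x < d -> P x.
Proof.
split=> [/nbhs_norm0P[e /= e0 eP]|[d d0 dP]].
  have eE : e = (complex.Re e)%:C by rewrite RRe_real // gtr0_real.
  exists (complex.Re e); first by rewrite -ltcR -eE.
  by move=> x xd; apply: eP; rewrite /= rnormE eE ltcR.
apply/nbhs_norm0P; exists d%:C => /=; first by rewrite (ltcR 0).
by move=> x /=; rewrite rnormE ltcR => /dP.
Qed.

(** Geometrically convergent sequences have a limit. This form of completeness
    passes from the real numbers to pairs of complex matrices by working with
    the entries. *)
Definition geometric_complete (V : normedModType C) :=
  exists2 k : R, 0 <= k & forall (c : R) (u : nat -> V),
    (forall n, rnorm (u n.+1 - u n) <= c * 2^-1 ^+ n) ->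
    exists w, forall n, rnorm (u n - w) <= k * c * 2^-1 ^+ n.

Lemma half_gt0 n : 0 < 2^-1 ^+ n :> R.
Proof. by rewrite exprn_gt0 ?invr_gt0. Qed.

(** The sequence [u n - 2 c / 2^n] is nondecreasing, [u n + 2 c / 2^n] is
    nonincreasing, and the supremum of the first one lies between them. *)
Lemma real_geometric_complete (c : R) (u : nat -> R) :
  (forall n, `|u n.+1 - u n| <= c * 2^-1 ^+ n) ->
  exists w, forall n, `|u n - w| <= 2 * c * 2^-1 ^+ n.
Proof.
move=> uc; have c0 : 0 <= c.
  by have := uc 0; rewrite expr0 mulr1; apply: le_trans.
pose a n := u n - 2 * c * 2^-1 ^+ n; pose b n := u n + 2 * c * 2^-1 ^+ n.
have aS n : a n <= a n.+1.
  by have := uc n; rewrite ler_norml /a exprS => /andP[]; nra.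
have bS n : b n.+1 <= b n.
  by have := uc n; rewrite ler_norml /b exprS => /andP[]; nra.
have am n m : (n <= m)%N -> a n <= a m.
  by elim: m => [|m IHm];
    [case: n | rewrite leq_eqVlt => /predU1P[->//|/IHm/le_trans->]].
have bm n m : (n <= m)%N -> b m <= b n.
  elim: m => [|m IHm]; first by case: n.
  by rewrite leq_eqVlt => /predU1P[->//|/IHm]; apply: le_trans.
have ab n m : a n <= b m.
  apply: (le_trans (am _ _ (leq_maxl n m))).
  apply: le_trans (bm _ _ (leq_maxr n m)).
  by have := half_gt0 (maxn n m); rewrite /a /b; nra.
have sa : has_sup (range a).
  split; first by exists (a 0%N), 0%N.
  by exists (b 0%N) => _ [n _ <-].
exists (sup (range a)) => n; rewrite ler_distl; apply/andP; split.
  rewrite lerBlDr; apply: ge_sup; first by case: sa.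
  by move=> _ [m _ <-]; apply: ab.
rewrite -lerBlDr; apply: sup_upper_bound sa _ _; by exists n.
Qed.

Lemma geometric_le0 (x k : R) : (forall n, x <= k * 2^-1 ^+ n) -> x <= 0.
Proof.
move=> xk; rewrite leNgt; apply/negP => x0.
have k0 : 0 < k by have := xk 0%N; rewrite expr0 mulr1; apply: lt_le_trans.
have := @upper_nthrootP R (k / x) _ (leqnn _); rewrite ltr_pdivrMr //.
set n := Num.bound _; have := xk n; rewrite exprVn ler_pdivlMr ?exprn_gt0 //.
by rewrite mulrC leNgt => /negP.
Qed.

Lemma le_rnorm_Re (z : C) : `|complex.Re z| <= rnorm (z : C^o).
Proof. by rewrite -lecR -rnormE; apply: normc_ge_Re. Qed.

Lemma le_rnorm_Im (z : C) : `|complex.Im z| <= rnorm (z : C^o).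
Proof.
have -> : complex.Im z = - complex.Re (z * 'i%C) by rewrite ReiNIm opprK.
rewrite normrN (le_trans (le_rnorm_Re _)) //.
rewrite -lecR -!rnormE normrM (_ : `|'i%C| = 1) ?mulr1 //.
by rewrite normc_def /= expr0n expr1n add0r sqrtr1.
Qed.

Lemma rnorm_complex_le (z : C) :
  rnorm (z : C^o) <= `|complex.Re z| + `|complex.Im z|.
Proof.
rewrite -lecR rmorphD /= -rnormE [in leLHS](complexE z).
apply: le_trans (ler_normD _ _) _; rewrite normrM (_ : `|'i%C| = 1) ?mul1r.
  by rewrite !normc_def /= !expr0n /= !addr0 !sqrtr_sqr.
by rewrite normc_def /= expr0n expr1n add0r sqrtr1.
Qed.

Lemma complex_geometric_complete : geometric_complete C^o.
Proof.
exists 4 => // c u uc.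
have [x xP] : exists x, forall n,
    `|complex.Re (u n) - x| <= 2 * c * 2^-1 ^+ n.
  apply: real_geometric_complete => n; apply: le_trans (uc n).
  by rewrite -raddfB; apply: le_rnorm_Re.
have [y yP] : exists y, forall n,
    `|complex.Im (u n) - y| <= 2 * c * 2^-1 ^+ n.
  apply: real_geometric_complete => n; apply: le_trans (uc n).
  by rewrite -raddfB; apply: le_rnorm_Im.
exists (x +i* y)%C => n; apply: le_trans (rnorm_complex_le _) _.
by have := xP n; have := yP n; rewrite !raddfB /=; lra.
Qed.

Lemma le_rnorm_entry m n (M : 'M[C]_(m, n)) i j : rnorm (M i j : C^o) <= rnorm M.
Proof.
have : `|M i j| <= mx_norm M.
  rewrite mx_normE -[leLHS]nngE num_le.
  exact: (le_bigmax _ (fun i => `|M i.1 i.2|%:nng) (i, j)).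
by rewrite -[mx_norm M]/`|M| -le_normC.
Qed.

Lemma rnorm_mx_le m n (M : 'M[C]_(m, n)) c : 0 <= c ->
  (forall i j, rnorm (M i j : C^o) <= c) -> rnorm M <= c.
Proof.
move=> c0 Mc; have [/mx_norm_eq0->|/mx_norm_neq0[[i j] /= E]] := eqVneq (mx_norm M) 0.
  by rewrite rnorm0.
by apply: le_trans (Mc i j); rewrite -le_normC -[leRHS]E.
Qed.

Lemma mx_geometric_complete m n : geometric_complete 'M[C]_(m, n).
Proof.
have [k k0 kP] := complex_geometric_complete; exists k => // c u uc.
have c0 : 0 <= c.
  by have := uc 0; rewrite expr0 mulr1; apply: le_trans (rnorm_ge0 _).
have /(_ _)/cid-/all_sig[w wP] (ij : 'I_m * 'I_n) :
    exists w : C^o, forall n, rnorm ((u n ij.1 ij.2 : C^o) - w) <= k * c * 2^-1 ^+ n.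
  apply: kP => l; apply: le_trans (uc l);
    apply: le_trans (le_rnorm_entry _ ij.1 ij.2).
  by rewrite !mxE.
exists (\matrix_(i, j) w (i, j)) => l; apply: rnorm_mx_le => [|i j].
  by rewrite !mulr_ge0 // ltW // half_gt0.
by rewrite !mxE; apply: (wP (i, j)).
Qed.

Lemma rnorm_pair_le (U V : normedModType C) (x : U * V) c :
  (rnorm x <= c) <-> (rnorm x.1 <= c /\ rnorm x.2 <= c).
Proof.
have E : rnorm x = Num.max (rnorm x.1) (rnorm x.2).
  have nE : `|x| = Num.max `|x.1| `|x.2| by [].
  rewrite /rnorm nE /Order.max.
  have -> : (`|x.1| < `|x.2|) = (rnorm x.1 < rnorm x.2).
    by rewrite -ltcR -!rnormE.
  by case: ifP.
by rewrite E ge_max; split=> [/andP|[-> ->]].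
Qed.

Lemma le_rnorm_fst (U V : normedModType C) (x : U * V) : rnorm x.1 <= rnorm x.
Proof. by have [] := (rnorm_pair_le x (rnorm x)).1 (lexx _). Qed.

Lemma le_rnorm_snd (U V : normedModType C) (x : U * V) : rnorm x.2 <= rnorm x.
Proof. by have [] := (rnorm_pair_le x (rnorm x)).1 (lexx _). Qed.

Lemma pair_geometric_complete (U V : normedModType C) :
  geometric_complete U -> geometric_complete V ->
  geometric_complete (U * V)%type.
Proof.
move=> [k k0 kP] [k' k'0 k'P]; exists (k + k'); first exact: addr_ge0.
move=> c u uc; have c0 : 0 <= c.
  by have := uc 0; rewrite expr0 mulr1; apply: le_trans (rnorm_ge0 _).
have [w wP] : exists w, forall n, rnorm ((u n).1 - w) <= k * c * 2^-1 ^+ n.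
  by apply: kP => n; apply: le_trans (uc n); apply: (le_rnorm_fst (_ - _)).
have [w' w'P] : exists w, forall n, rnorm ((u n).2 - w) <= k' * c * 2^-1 ^+ n.
  by apply: k'P => n; apply: le_trans (uc n); apply: (le_rnorm_snd (_ - _)).
exists (w, w') => n; apply/rnorm_pair_le.
have ge0 a : 0 <= a -> 0 <= a * c * 2^-1 ^+ n.
  by move=> a0; rewrite !mulr_ge0 // ltW // half_gt0.
by have := wP n; have := w'P n; have := ge0 _ k0; have := ge0 _ k'0 => /=; lra.
Qed.

Lemma contraction_fixpoint (V : normedModType C) (T : V -> V) (r : R) :
  geometric_complete V -> 0 <= r ->
  (forall x, rnorm x <= r -> rnorm (T x) <= r) ->
  (forall x y, rnorm x <= r -> rnorm y <= r ->
     rnorm (T x - T y) <= 2^-1 * rnorm (x - y)) ->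
  exists2 w, rnorm w <= r & T w = w.
Proof.
move=> [k k0 kP] r0 Tr Tc; pose u n := iter n T 0.
have ur n : rnorm (u n) <= r by elim: n => [|n /Tr //]; rewrite rnorm0.
have [w wP] : exists w, forall n, rnorm (u n - w) <= k * r * 2^-1 ^+ n.
  apply: kP; elim=> [|n IHn]; first by rewrite /= subr0 expr0 mulr1 (ur 1%N).
  have TcS : rnorm (u n.+2 - u n.+1) <= 2^-1 * rnorm (u n.+1 - u n)
    by exact: (Tc _ _ (ur n.+1) (ur n)).
  by apply: le_trans TcS _; rewrite exprS mulrCA ler_pM2l ?invr_gt0.
have wr : rnorm w <= r.
  rewrite -subr_le0; apply: (@geometric_le0 _ (k * r)) => n.
  rewrite lerBlDr; apply: le_trans (_ : rnorm (w - u n) + rnorm (u n) <= _).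
    by apply: le_trans (rnormD _ _); rewrite subrK.
  by rewrite rdistC lerD.
exists w => //; apply/eqP; rewrite -subr_eq0; apply/eqP/rnorm_eq0/le_anti.
rewrite rnorm_ge0 andbT; apply: (@geometric_le0 _ (2 * (k * r))) => n.
have -> : T w - w = (T w - T (u n)) + (u n.+1 - w) by rewrite addrA subrK.
apply: le_trans (rnormD _ _) _; have := Tc _ _ wr (ur n).
rewrite [rnorm (w - _)]rdistC; have := wP n; have := wP n.+1; rewrite exprS.
have : 0 <= k * r * 2^-1 ^+ n by rewrite !mulr_ge0 // ltW // half_gt0.
by set a := 2^-1 ^+ n; lra.
Qed.

End RealNorm.

(** * A holomorphic solution of a quadratic equation *)

Section Quadratic.
Variable R : realType.
Local Notation C := (Cplx R).

Lemma rnorm_bound_continuous (V W : normedModType C) (f : {linear V -> W}) k :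
  (forall h, rnorm (f h) <= k * rnorm h) -> continuous f.
Proof.
move=> fk; apply/linear_bounded_continuous/linear_boundedP.
near=> r => x; apply: (@le_trans _ _ (k%:C * `|x|)).
  by rewrite !rnormE -rmorphM /= lecR.
apply: ler_wpM2r => //; near: r; apply: nbhs_pinfty_ge.
by apply/complex_realP; exists k.
Unshelve. all: by end_near. Qed.

(** A remainder of second order is a convenient substitute for little-o: it is
    what equations with bilinear terms provide. *)
Lemma differentiable_quadratic (V W : normedModType C) (f : V -> W) x
    (df : {linear V -> W}) (k c d : R) :
  (forall h, rnorm (df h) <= k * rnorm h) -> 0 < d ->
  (forall h, rnorm h < d ->
     rnorm (f (x + h) - f x - df h) <= c * rnorm h ^+ 2) ->
  differentiable f x.
Proof.
move=> dfk d0 fd; have dfc := rnorm_bound_continuous dfk.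
have E : f \o shift x = cst (f x) + df +o_ (nbhs (0 : V)) id.
  apply/eqaddoP => e e0; apply/near0P.
  have eE : e = (complex.Re e)%:C by rewrite RRe_real // gtr0_real.
  have {}e0 : 0 < complex.Re e by rewrite -ltcR -eE.
  exists (Num.min d (complex.Re e / (1 + `|c|))).
    by rewrite lt_min d0 divr_gt0 // ltr_wpDr.
  move=> h; rewrite lt_min => /andP[hd he] /=.
  rewrite !rnormE eE -rmorphM /= lecR !fctE /= opprD addrA [h + x]addrC.
  apply: le_trans (fd _ hd) _; rewrite expr2 mulrA ler_wpM2r ?rnorm_ge0 //.
  move: he; rewrite ltr_pdivlMr ?ltr_wpDr // => he.
  by have := ler_norm c; have := rnorm_ge0 h; nra.
by apply/diff_locallyP; rewrite (diff_unique dfc E).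
Qed.

Lemma blinB (U V W : lmodType C) (b : {bilinear U -> V -> W}) x y x' y' :
  b x y - b x' y' = b x (y - y') + b (x - x') y'.
Proof. by rewrite linearBr linearBl addrA subrK. Qed.

Section Solution.
Variables (V : normedModType C) (b q : {bilinear V -> V -> V}) (c : R).
Hypothesis V_complete : geometric_complete V.
Hypothesis c_gt0 : 0 < c.
Hypothesis b_bounded : forall x y, rnorm (b x y) <= c * (rnorm x * rnorm y).
Hypothesis q_bounded : forall x y, rnorm (q x y) <= c * (rnorm x * rnorm y).

(** On the ball of radius [r] each bilinear term has Lipschitz constant at most
    [1/8] in each argument, so that three such terms form a contraction of ratio
    less than [1/2]; the bound [d] on [E] keeps this ball invariant. *)
Let r := (8 * c)^-1.
Let d := r / 4.

Let r_gt0 : 0 < r. Proof. by rewrite invr_gt0 mulr_gt0. Qed.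
Let d_gt0 : 0 < d. Proof. by rewrite divr_gt0. Qed.
Let cr : c * r = 8^-1. Proof. by rewrite /r; field; rewrite gt_eqF. Qed.

(** The derivative in [w] of the map [E + b E w + q w w], a contraction at
    small points. *)
Let K E w u := b E u + q w u + q u w.

Let K_le E w w' u : rnorm E <= r -> rnorm w <= r -> rnorm w' <= r ->
  rnorm (b E u + q w u + q u w') <= 2^-1 * rnorm u.
Proof.
move=> Er wr w'r; apply: le_trans (rnormD _ _) _.
apply: le_trans (lerD (rnormD _ _) (lexx _)) _.
have := b_bounded E u; have := q_bounded w u; have := q_bounded u w'.
have ru := rnorm_ge0 u.
have small (x : V) : rnorm x <= r -> c * (rnorm x * rnorm u) <= 8^-1 * rnorm u.
  by move=> xr; rewrite mulrA -cr ler_wpM2r // ler_wpM2l // ltW.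
by rewrite [rnorm u * _]mulrC; have := small _ Er; have := small _ wr;
  have := small _ w'r; lra.
Qed.

Let K_linear E w : linear (K E w).
Proof.
move=> a x y; rewrite /K !linearPr !linearPl !scalerDr !addrA.
by rewrite [LHS](ACl (1*3*5*2*4*6)).
Qed.

Let d_le_r (E : V) : rnorm E < d -> rnorm E <= r.
Proof. by move=> /ltW Ed; have := r_gt0; move: Ed; rewrite /d; lra. Qed.

Lemma quadratic_fixpoint E : rnorm E < d ->
  exists2 w, rnorm w <= r & E + b E w + q w w = w.
Proof.
move=> Ed; apply: contraction_fixpoint => [||w wr|x y xr yr] //;
  first exact: ltW.
  apply: le_trans (rnormD _ _) _;
    apply: le_trans (lerD (rnormD _ _) (lexx _)) _.
  have : rnorm E <= r / 4 := ltW Ed.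
  have := b_bounded E w; have := q_bounded w w; have := rnorm_ge0 w.
  have small (x : V) : rnorm x <= r -> c * (rnorm x * rnorm w) <= 8^-1 * rnorm w.
    by move=> xr; rewrite mulrA -cr ler_wpM2r ?rnorm_ge0 // ler_wpM2l // ltW.
  by have := small _ (d_le_r Ed); have := small _ wr; have := r_gt0; lra.
have -> : E + b E x + q x x - (E + b E y + q y y) =
    b E (x - y) + q x (x - y) + q (x - y) y.
  rewrite -[X in _ = X]addrA -blinB linearBr !opprD addrACA.
  by rewrite [X in X + _]addrACA subrr add0r.
by apply: K_le => //; apply: d_le_r.
Qed.

Let K_unique E w x : rnorm E <= r -> rnorm w <= r -> x = K E w x -> x = 0.
Proof.
move=> Er wr xK; apply: rnorm_eq0; apply/le_anti; rewrite rnorm_ge0 andbT.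
by have := K_le x Er wr wr; rewrite -/(K E w x) -xK; lra.
Qed.

(** The inverse of [1 - K E w], obtained as a family of fixed points. *)
Let resolvent E w : rnorm E <= r -> rnorm w <= r ->
  exists2 X : {linear V -> V}, forall v, X v = v + K E w (X v) &
    forall v, rnorm (X v) <= 2 * rnorm v.
Proof.
move=> Er wr.
have /(_ _)/cid2-/all_sig2[X Xle XE] v : exists2 x, rnorm x <= 2 * rnorm v &
    v + K E w x = x.
  apply: contraction_fixpoint => [||x xv|x y _ _] //.
  - by rewrite mulr_ge0 ?rnorm_ge0.
  - apply: le_trans (rnormD _ _) _.
    by have := K_le x Er wr wr; rewrite -/(K E w x); lra.
  have -> : v + K E w x - (v + K E w y) = K E w (x - y).
    by rewrite opprD addrACA subrr add0r -(zmod_morphism_linear (K_linear E w)).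
  exact: K_le.
have XL : linear X.
  move=> a x y; apply/eqP; rewrite -subr_eq0; apply/eqP.
  apply: (K_unique Er wr); rewrite (zmod_morphism_linear (K_linear E w)).
  rewrite [X in _ = _ - X]K_linear; set z := X (a *: x + y).
  have -> : a *: X x + X y = a *: x + y + (a *: K E w (X x) + K E w (X y)).
    by rewrite -{1}(XE x) -{1}(XE y) scalerDr addrACA.
  by rewrite -{1}[z]XE opprD addrACA subrr add0r.
exists (HB.pack_for {linear V -> V} X (GRing.isLinear.Build _ _ _ _ X XL)) => v /=; last exact: Xle.
by rewrite XE.
Qed.

(** The increment [u] of the solution satisfies [u = B h + K u + O(h^2)] where
    [B h = h + b h w]; hence the inverse of [1 - K] applied to [B] is its
    differential. *)
Lemma quadratic_solution_local : exists g : V -> V,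
  [/\ holomorphic_at0 g, g 0 = 0 &
      \forall E \near (0 : V), g E = E + b E (g E) + q (g E) (g E)].
Proof.
have /(_ _)/cid-/all_sig[g gP] E : exists w, rnorm E < d ->
    rnorm w <= r /\ E + b E w + q w w = w.
  have [/quadratic_fixpoint[w wr wE]|] := boolP (rnorm E < d);
    first by exists w.
  by exists 0.
exists g; split; last first.
- by apply/near0P; exists d => // E /gP[].
- have [|g0r g0E] := gP 0; first by rewrite rnorm0.
  have r0 : rnorm (0 : V) <= r by rewrite rnorm0 ltW.
  have := K_le (g 0) r0 g0r r0; rewrite linear0r addr0.
  rewrite -[b 0 _ + _]add0r addrA g0E => h; apply: rnorm_eq0.
  by apply/le_anti; rewrite rnorm_ge0 andbT; lra.
apply/near0P; exists (d / 2) => [|E Ed2]; first by rewrite divr_gt0.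
have Ed : rnorm E < d by move: Ed2 d_gt0; lra.
have [wr wE] := gP E Ed; set w := g E in wr wE *.
have [X XE X2] := resolvent (d_le_r Ed) wr.
have small (x y : V) : rnorm x <= r -> c * (rnorm x * rnorm y) <= 8^-1 * rnorm y.
  by move=> xr; rewrite mulrA -cr ler_wpM2r ?rnorm_ge0 // ler_wpM2l // ltW.
pose B h := h + b h w.
have BL : linear B.
  by move=> a x y; rewrite /B linearPl scalerDr addrACA.
pose XB := X \o (HB.pack_for {linear V -> V} B (GRing.isLinear.Build _ _ _ _ B BL)).
have B_le h : rnorm (B h) <= 9 / 8 * rnorm h.
  apply: le_trans (rnormD _ _) _; have := b_bounded h w; have := small w h wr.
  by rewrite [rnorm w * _]mulrC; lra.
apply: (@differentiable_quadratic _ _ g E XB 3 (24 * c) (d / 2)).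
- by move=> h; have := X2 (B h); have := B_le h; have := rnorm_ge0 h => /=; lra.
- by rewrite divr_gt0.
move=> h hd; have E'd : rnorm (E + h) < d.
  by apply: le_lt_trans (rnormD _ _) _; move: Ed2 hd; lra.
have [w'r w'E] := gP _ E'd; set w' := g (E + h) in w'r w'E *.
rewrite /= -/(B h); set u := w' - w.
have uE : u = h + (b (E + h) u + b h w) + (q w' u + q u w).
  rewrite /u -{1}w'E -{1}wE !opprD addrACA [X in X + _]addrACA.
  by rewrite !blinB -/u !(addrC E) !addrK.
have uh : rnorm u <= 3 * rnorm h.
  have := K_le u (d_le_r E'd) w'r wr.
  have := b_bounded h w; have := small w h wr; rewrite [rnorm w * _]mulrC.
  have : rnorm u <= rnorm h + rnorm (b h w) +
      rnorm (b (E + h) u + q w' u + q u w).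
    rewrite {1}uE; apply: le_trans (_ : rnorm (h + b h w +
      (b (E + h) u + q w' u + q u w)) <= _); last first.
      by apply: le_trans (rnormD _ _) _; rewrite lerD2r rnormD.
    by rewrite !addrA [leLHS](_ : _ = rnorm (h + b h w + b (E + h) u + q w' u + q u w))
      // [in LHS](ACl (1*3*2*4*5)).
  by have := rnorm_ge0 h; lra.
have uK : u = B h + K E w u + (b h u + q u u).
  rewrite {1}uE.
  have -> : b (E + h) u = b E u + b h u by rewrite linearDl.
  have -> : q w' u = q w u + q u u by rewrite -linearDl addrC subrK.
  by rewrite /K /B !addrA [LHS](ACl (1*4*2*5*7*3*6)).
set y := u - X (B h).
have yE : y = K E w y + (b h u + q u u).
  rewrite (zmod_morphism_linear (K_linear E w)) {1}/y {1}XE {1}uK.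
  have zmodE (a k p x : V) : a + k + p - (a + x) = k - x + p.
    by rewrite opprD -[a + k + p]addrA addrACA subrr add0r addrAC.
  exact: zmodE.
have ye : rnorm y <= 2^-1 * rnorm y + rnorm (b h u + q u u).
  rewrite {1}yE; apply: le_trans (rnormD _ _) _; rewrite lerD2r.
  by apply: K_le => //; apply: d_le_r.
have := rnormD (b h u) (q u u); have := b_bounded h u; have := q_bounded u u.
have h0 := rnorm_ge0 h; have u0 := rnorm_ge0 u; rewrite expr2.
have : c * (rnorm h * rnorm u) <= c * (rnorm h * (3 * rnorm h)).
  by rewrite ler_pM2l // ler_wpM2l.
have : c * (rnorm u * rnorm u) <= c * ((3 * rnorm h) * (3 * rnorm h)).
  by rewrite ler_pM2l // ler_pM.
by move: ye; nra.
Qed.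

End Solution.
End Quadratic.

(** * Miniversality of star deformations *)

Section Miniversal.
Variable R : realType.
Local Notation C := (Cplx R).

Lemma mx_pair_sum m n (w : mx_pair R m n) :
  w = \sum_i \sum_j (w.1 i j *: ((delta_mx i j, 0) : mx_pair R m n)) +
      \sum_i \sum_j (w.2 i j *: ((0, delta_mx i j) : mx_pair R m n)).
Proof.
have fstE (I : finType) (F : I -> mx_pair R m n) : (\sum_i F i).1 = \sum_i (F i).1.
  by elim/big_rec2: _ => // i x y _ <-.
have sndE (I : finType) (F : I -> mx_pair R m n) : (\sum_i F i).2 = \sum_i (F i).2.
  by elim/big_rec2: _ => // i x y _ <-.
apply: injective_projections.
  rewrite /= !fstE [in LHS](matrix_sum_delta w.1).
  rewrite [X in _ = _ + X]big1 ?addr0 => [|i _]; last first.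
    by rewrite fstE big1 // => j _; rewrite /= scaler0.
  by apply: eq_bigr => i _; rewrite fstE.
rewrite /= !sndE [in LHS](matrix_sum_delta w.2).
rewrite [X in _ = X + _]big1 ?add0r => [|i _]; last first.
  by rewrite sndE big1 // => j _; rewrite /= scaler0.
by apply: eq_bigr => i _; rewrite sndE.
Qed.

Lemma linear_mx_pair_bounded m n (W : normedModType C)
    (f : {linear mx_pair R m n -> W}) :
  exists2 k, 0 < k & forall w, rnorm (f w) <= k * rnorm w.
Proof.
pose k1 := \sum_i \sum_j rnorm (f (delta_mx i j, 0)).
pose k2 := \sum_i \sum_j rnorm (f (0, delta_mx i j)).
have k10 : 0 <= k1 by rewrite sumr_ge0 // => i _; rewrite sumr_ge0 // => j _;
  apply: rnorm_ge0.
have k20 : 0 <= k2 by rewrite sumr_ge0 // => i _; rewrite sumr_ge0 // => j _;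
  apply: rnorm_ge0.
exists (1 + k1 + k2) => [|w]; first by rewrite -addrA ltr_pwDl // addr_ge0.
suff : rnorm (f w) <= k1 * rnorm w + k2 * rnorm w by have := rnorm_ge0 w; lra.
rewrite {1}[w]mx_pair_sum linearD; apply: le_trans (rnormD _ _) _.
rewrite !raddf_sum; apply: lerD.
  apply: le_trans (rnorm_sum _) _; rewrite mulr_suml; apply: ler_sum => i _.
  rewrite raddf_sum; apply: le_trans (rnorm_sum _) _; rewrite mulr_suml.
  apply: ler_sum => j _;
    rewrite /= linearZZ rnormZ mulrC ler_wpM2l ?rnorm_ge0 //.
  exact: le_trans (le_rnorm_entry _ i j) (le_rnorm_fst w).
apply: le_trans (rnorm_sum _) _; rewrite mulr_suml; apply: ler_sum => i _.
rewrite raddf_sum; apply: le_trans (rnorm_sum _) _; rewrite mulr_suml.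
apply: ler_sum => j _; rewrite /= linearZZ rnormZ mulrC ler_wpM2l ?rnorm_ge0 //.
exact: le_trans (le_rnorm_entry _ i j) (le_rnorm_snd w).
Qed.

Lemma linear_rV_bounded k (W : normedModType C) (f : {linear 'rV[C]_k -> W}) :
  exists2 c, 0 < c & forall a, rnorm (f a) <= c * rnorm a.
Proof.
pose c := \sum_j rnorm (f (delta_mx 0 j)).
have c0 : 0 <= c by rewrite sumr_ge0 // => j _; apply: rnorm_ge0.
exists (1 + c) => [|a]; first by rewrite ltr_pwDl.
suff : rnorm (f a) <= c * rnorm a by have := rnorm_ge0 a; lra.
rewrite {1}[a]row_sum_delta raddf_sum; apply: le_trans (rnorm_sum _) _.
rewrite mulr_suml; apply: ler_sum => j _; rewrite /= linearZZ rnormZ mulrC.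
by rewrite ler_wpM2l ?rnorm_ge0 // le_rnorm_entry.
Qed.

Lemma rnorm_mulmx m n p (X : 'M[C]_(m, n)) (Y : 'M[C]_(n, p)) :
  rnorm (X *m Y) <= n%:R * (rnorm X * rnorm Y).
Proof.
apply: rnorm_mx_le => [|i j].
  by rewrite !mulr_ge0 ?rnorm_ge0.
rewrite mxE; apply: le_trans (@rnorm_sum _ C^o _ _) _.
rewrite -[n in n%:R]card_ord mulr_natl -sumr_const; apply: ler_sum => l _.
rewrite (_ : rnorm _ = rnorm (X i l : C^o) * rnorm (Y l j : C^o)).
  by rewrite ler_pM ?rnorm_ge0 ?le_rnorm_entry.
by rewrite -rnormZ.
Qed.

(** A row vector killed by [X] is reproduced by [1 - X], which shrinks norms. *)
Lemma unitmx_near1 m (X : 'M[C]_m) :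
  m%:R * rnorm (X - 1%:M) < 1 -> X \in unitmx.
Proof.
move=> X1; rewrite -row_free_unit -kermx_eq0; apply/rowV0P => v /sub_kermxP vX.
apply: rnorm_eq0; apply/le_anti; rewrite rnorm_ge0 andbT.
have : v = - (v *m (X - 1%:M)) by rewrite mulmxBr vX mulmx1 sub0r opprK.
move/(congr1 (@rnorm R _)); rewrite rnormN.
have := rnorm_mulmx v (X - 1%:M); have := rnorm_ge0 v.
have := rnorm_ge0 (X - 1%:M).
by set a := rnorm v; set b := rnorm (X - _) in X1 *; nra.
Qed.

Lemma near_unitmx (V : normedModType C) m (S : V -> 'M[C]_m) :
  differentiable S 0 -> S 0 = 1%:M -> \forall E \near (0 : V), S E \in unitmx.
Proof.
move=> /differentiable_continuous; rewrite /prop_for /continuous_at => Sc S0.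
have e0 : 0 < ((m%:R + 1)^-1 : R)%:C by rewrite (ltcR 0) invr_gt0 ltr_wpDl.
have : \forall E \near (0 : V), `|S 0 - S E| < ((m%:R + 1)^-1 : R)%:C.
  by apply: cvgr_dist_lt.
apply: filterS => E; rewrite S0 distrC rnormE ltcR => lt; apply: unitmx_near1.
move: lt; rewrite -[X in _ < X -> _]mul1r ltr_pdivlMr ?ltr_wpDl //.
by have := rnorm_ge0 (S E - 1%:M); lra.
Qed.

(** It suffices to choose [s] and [x] for the matrix units and to extend them
    linearly. *)
Lemma complement_linear_inverse m n (A B : 'M[C]_(m, n)) SP SQ :
  complement A B A B SP SQ ->
  exists (s : {linear mx_pair R m n -> 'M[C]_m})
         (x : {linear mx_pair R m n -> 'M[C]_n}),
  forall w : mx_pair R m n, supported SP (w.1 - (s w *m A - A *m x w)) /\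
                            supported SQ (w.2 - (s w *m B - B *m x w)).
Proof.
case=> ex _.
have /(_ _)/cid-/all_sig[s1 s1P] (ij : 'I_m * 'I_n) := ex (delta_mx ij.1 ij.2) 0.
have /(_ _)/cid-/all_sig[x1 {s1P} P1] ij := s1P ij.
have /(_ _)/cid-/all_sig[s2 s2P] (ij : 'I_m * 'I_n) := ex 0 (delta_mx ij.1 ij.2).
have /(_ _)/cid-/all_sig[x2 {s2P} P2] ij := s2P ij.
pose ext (U : lmodType C) (f1 f2 : 'I_m * 'I_n -> U) (w : mx_pair R m n) :=
  \sum_ij w.1 ij.1 ij.2 *: f1 ij + \sum_ij w.2 ij.1 ij.2 *: f2 ij.
have extL U f1 f2 : linear (@ext U f1 f2).
  move=> a u v; rewrite /ext /= scalerDr addrACA !scaler_sumr -!big_split /=.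
  by apply: eq_bigr => ij _; rewrite !mxE !scalerDl !scalerA.
exists (HB.pack_for {linear mx_pair R m n -> 'M[C]_m} (@ext _ s1 s2)
  (GRing.isLinear.Build _ _ _ _ (@ext _ s1 s2) (@extL _ s1 s2))).
exists (HB.pack_for {linear mx_pair R m n -> 'M[C]_n} (@ext _ x1 x2)
  (GRing.isLinear.Build _ _ _ _ (@ext _ x1 x2) (@extL _ x1 x2))).
move=> w /=.
have E (D M : 'M[C]_(m, n)) (u1 u2 : 'I_m * 'I_n -> 'M[C]_(m, n)) :
    M = \sum_ij w.1 ij.1 ij.2 *: u1 ij + \sum_ij w.2 ij.1 ij.2 *: u2 ij ->
    M - (ext _ s1 s2 w *m D - D *m ext _ x1 x2 w) =
    \sum_ij w.1 ij.1 ij.2 *: (u1 ij - (s1 ij *m D - D *m x1 ij)) +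
    \sum_ij w.2 ij.1 ij.2 *: (u2 ij - (s2 ij *m D - D *m x2 ij)).
  move=> ->.
  have T a (u : 'M[C]_(m, n)) s x : a *: (u - (s *m D - D *m x)) =
      a *: u - ((a *: s) *m D - D *m (a *: x)).
    by rewrite !scalerBr scalemxAl scalemxAr.
  rewrite (eq_bigr _ (fun ij _ => T (w.1 ij.1 ij.2) _ _ _)).
  rewrite [X in _ = _ + X](eq_bigr _ (fun ij _ => T (w.2 ij.1 ij.2) _ _ _)).
  rewrite [X in _ = X + _]sumrB [X in _ = _ + X]sumrB.
  rewrite [X in _ = _ - X + _]sumrB [X in _ = _ + (_ - X)]sumrB.
  rewrite -!mulmx_suml -!mulmx_sumr [in LHS]/ext mulmxDl mulmxDr.
  have zmodE (M1 M2 a1 a2 b1 b2 : 'M[C]_(m, n)) :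
      M1 + M2 - (a1 + a2 - (b1 + b2)) = M1 - (a1 - b1) + (M2 - (a2 - b2)).
    by rewrite (opprD b1) (addrACA a1) opprD addrACA.
  exact: zmodE.
have supp_sum (S : 'M[bool]_(m, n)) (a1 a2 : 'I_m * 'I_n -> C)
    (u1 u2 : 'I_m * 'I_n -> 'M[C]_(m, n)) :
    (forall ij, supported S (u1 ij)) -> (forall ij, supported S (u2 ij)) ->
    supported S (\sum_ij a1 ij *: u1 ij + \sum_ij a2 ij *: u2 ij).
  move=> h1 h2 i j Sij; rewrite mxE !summxE !big1 ?addr0 // => ij _;
    by rewrite mxE ?h1 ?h2 // mulr0.
split.
  rewrite (E A _ (fun ij => delta_mx ij.1 ij.2) (fun=> 0)); last first.
    rewrite [X in _ + X]big1 ?addr0 => [|ij _]; last by rewrite scaler0.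
    by rewrite [LHS]matrix_sum_delta pair_bigA.
  exact: (@supp_sum _ (fun ij => w.1 ij.1 ij.2) (fun ij => w.2 ij.1 ij.2) _ _
    (fun ij => proj1 (P1 ij)) (fun ij => proj1 (P2 ij))).
rewrite (E B _ (fun=> 0) (fun ij => delta_mx ij.1 ij.2)); last first.
  rewrite [X in X + _]big1 ?add0r => [|ij _]; last by rewrite scaler0.
  by rewrite [LHS]matrix_sum_delta pair_bigA.
exact: (@supp_sum _ (fun ij => w.1 ij.1 ij.2) (fun ij => w.2 ij.1 ij.2) _ _
  (fun ij => proj2 (P1 ij)) (fun ij => proj2 (P2 ij))).
Qed.

(** A direct complement of the tangent space meets every orbit near [(A, B)]:
    the equation [S (A + P) = (A + E1) Q] is rewritten with a linear right inverse
    of the tangent map as a quadratic equation for a pair of matrices [w]. *)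
Lemma complement_versal m n (A B : 'M[C]_(m, n)) SP SQ :
  complement A B A B SP SQ ->
  exists g (s : mx_pair R m n -> 'M[C]_m) (x : mx_pair R m n -> 'M[C]_n)
    (rho : {linear mx_pair R m n -> mx_pair R m n}),
  [/\ holomorphic_at0 g /\ g 0 = 0,
      holomorphic_at0 (fun E => 1%:M + s (g E)) /\ 1%:M + s (g 0) = 1%:M,
      holomorphic_at0 (fun E => 1%:M + x (g E)) /\ 1%:M + x (g 0) = 1%:M,
      forall w, supported SP (rho w).1 /\ supported SQ (rho w).2 &
      \forall E \near (0 : mx_pair R m n),
        (A + (rho (g E)).1, B + (rho (g E)).2) =
        (invmx (1%:M + s (g E)) *m (A + E.1) *m (1%:M + x (g E)),
         invmx (1%:M + s (g E)) *m (B + E.2) *m (1%:M + x (g E)))].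
Proof.
move=> /complement_linear_inverse[s [x sxP]].
pose rho (w : mx_pair R m n) : mx_pair R m n :=
  (w.1 - (s w *m A - A *m x w), w.2 - (s w *m B - B *m x w)).
have rhoL : linear rho.
  have T (D : 'M[C]_(m, n)) a (M M' : 'M[C]_(m, n)) u v :
      a *: M + M' - (s (a *: u + v) *m D - D *m x (a *: u + v)) =
      a *: (M - (s u *m D - D *m x u)) + (M' - (s v *m D - D *m x v)).
    rewrite (linearP s) (linearP x) /= mulmxDl mulmxDr !scalerBr scalemxAl scalemxAr.
    set a1 := _ *m D; set a2 := _ *m D; set b1 := D *m _; set b2 := D *m _.
    by rewrite (opprD b1) (addrACA a1) opprD addrACA.
  by move=> a u v; apply: injective_projections; apply: T.
have rho1 w : (rho w).1 = w.1 - (s w *m A - A *m x w) by [].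
have rho2 w : (rho w).2 = w.2 - (s w *m B - B *m x w) by [].
clearbody rho.
pose rhoM : {linear mx_pair R m n -> mx_pair R m n} := HB.pack_for
  {linear mx_pair R m n -> mx_pair R m n} rho (GRing.isLinear.Build _ _ _ _ rho rhoL).
pose bf (E w : mx_pair R m n) : mx_pair R m n := (E.1 *m x w, E.2 *m x w).
pose qf (w w' : mx_pair R m n) : mx_pair R m n :=
  (- (s w *m (rho w').1), - (s w *m (rho w').2)).
have bL : bilinear_for (GRing.Scale.Law.clone _ _ *:%R _)
    (GRing.Scale.Law.clone _ _ *:%R _) bf.
  split=> [w|E] a u v; apply: injective_projections => /=.
  - by rewrite mulmxDl scalemxAl.
  - by rewrite mulmxDl scalemxAl.
  - by rewrite (linearP x) mulmxDr scalemxAr.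
  - by rewrite (linearP x) mulmxDr scalemxAr.
have qL : bilinear_for (GRing.Scale.Law.clone _ _ *:%R _)
    (GRing.Scale.Law.clone _ _ *:%R _) qf.
  split=> [w'|w] a u v; apply: injective_projections => /=.
  - by rewrite (linearP s) mulmxDl -scalemxAl opprD scalerN.
  - by rewrite (linearP s) mulmxDl -scalemxAl opprD scalerN.
  - by rewrite rhoL mulmxDr -scalemxAr opprD scalerN.
  - by rewrite rhoL mulmxDr -scalemxAr opprD scalerN.
pose b := HB.pack_for {bilinear mx_pair R m n -> mx_pair R m n -> mx_pair R m n} bf
  (bilinear_isBilinear.Build C _ _ _ _ _ bf bL).
pose q := HB.pack_for {bilinear mx_pair R m n -> mx_pair R m n -> mx_pair R m n} qf
  (bilinear_isBilinear.Build C _ _ _ _ _ qf qL).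
have [kx kx0 kxP] := linear_mx_pair_bounded x.
have [ks ks0 ksP] := linear_mx_pair_bounded s.
have [kr kr0 krP] := linear_mx_pair_bounded rhoM.
pose c := n%:R * kx + m%:R * (ks * kr) + 1.
have nx0 : 0 <= n%:R * kx by rewrite mulr_ge0 // ltW.
have ms0 : 0 <= m%:R * (ks * kr) by rewrite !mulr_ge0 // ltW.
have c0 : 0 < c by rewrite /c; lra.
have bc E w : rnorm (b E w) <= c * (rnorm E * rnorm w).
  apply: (@le_trans _ _ (n%:R * kx * (rnorm E * rnorm w))).
    have le1 (M : 'M[C]_(m, n)) : rnorm M <= rnorm E ->
        rnorm (M *m x w) <= n%:R * kx * (rnorm E * rnorm w).
      move=> ME; apply: le_trans (rnorm_mulmx _ _) _.
      by rewrite -mulrA ler_wpM2l // mulrCA ler_pM ?rnorm_ge0.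
    by apply/rnorm_pair_le; split; apply: le1;
      [apply: le_rnorm_fst | apply: le_rnorm_snd].
  by rewrite ler_wpM2r ?mulr_ge0 ?rnorm_ge0 // /c; lra.
have qc w w' : rnorm (q w w') <= c * (rnorm w * rnorm w').
  apply: (@le_trans _ _ (m%:R * (ks * kr) * (rnorm w * rnorm w'))).
    have le1 (M : 'M[C]_(m, n)) : rnorm M <= rnorm (rho w') ->
        rnorm (- (s w *m M)) <= m%:R * (ks * kr) * (rnorm w * rnorm w').
      move=> Mr; rewrite rnormN; apply: le_trans (rnorm_mulmx _ _) _.
      rewrite -mulrA ler_wpM2l // mulrACA ler_pM ?rnorm_ge0 //.
      exact: le_trans Mr (krP w').
    by apply/rnorm_pair_le; split; apply: le1;
      [apply: le_rnorm_fst | apply: le_rnorm_snd].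
  by rewrite ler_wpM2r ?mulr_ge0 ?rnorm_ge0 // /c; lra.
have Vc : geometric_complete (mx_pair R m n).
  by apply: pair_geometric_complete; apply: mx_geometric_complete.
have [g [gh g0 gE]] := quadratic_solution_local Vc c0 bc qc.
have affine_holo p (f : {linear mx_pair R m n -> 'M[C]_p}) :
    holomorphic_at0 (fun E => 1%:M + f (g E)).
  have [k _ fk] := linear_mx_pair_bounded f.
  move: gh; rewrite /holomorphic_at0; apply: filterS => E gd.
  apply: differentiableD; first exact: differentiable_cst.
  apply: (differentiable_comp gd); apply: linear_differentiable.
  exact: rnorm_bound_continuous fk.
exists g, s, x, rhoM; split.
- by [].
- by split; [apply: affine_holo | rewrite g0 linear0 addr0].
- by split; [apply: affine_holo | rewrite g0 linear0 addr0].
- by move=> w; rewrite rho1 rho2; apply: sxP.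
have uS : \forall E \near (0 : mx_pair R m n), 1%:M + s (g E) \in unitmx.
  apply: near_unitmx; last by rewrite g0 linear0 addr0.
  exact: nbhs_singleton (affine_holo _ s).
move: gE uS; apply: filterS2 => E gE uS; set w := g E in gE uS *.
have main (D E1 rho1' w1 : 'M[C]_(m, n)) : rho1' = w1 - (s w *m D - D *m x w) ->
    w1 = E1 + E1 *m x w - s w *m rho1' ->
    D + rho1' = invmx (1%:M + s w) *m (D + E1) *m (1%:M + x w).
  move=> rhoE wE; rewrite -mulmxA; apply: (canRL (mulKmx uS)).
  rewrite mulmxDl mul1mx (mulmxDr (s w)) [RHS]mulmxDr mulmx1 (mulmxDl D).
  have zmodE (e ex sr sd dx : 'M[C]_(m, n)) :
      D + (e + ex - sr - (sd - dx)) + (sd + sr) = D + e + (dx + ex).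
    rewrite opprB (addrACA (e + ex)) -opprD [sd + sr]addrC.
    rewrite -[LHS]addrA subrK.
    by rewrite -!addrA [ex + dx]addrC.
  by rewrite {1}rhoE {1}wE zmodE.
have wE1 : w.1 = E.1 + E.1 *m x w - s w *m (rho w).1 by rewrite {1}gE.
have wE2 : w.2 = E.2 + E.2 *m x w - s w *m (rho w).2 by rewrite {1}gE.
by apply: injective_projections; [apply: main wE1 | apply: main wE2].
Qed.

End Miniversal.

(** * Minimality of the number of parameters *)

Section Minimality.
Variable R : realType.
Local Notation C := (Cplx R).

Lemma diff_eq0_near (V W : normedModType C) (f : V -> W) :
  differentiable f 0 -> (\forall E \near (0 : V), f E = 0) -> 'd f 0 = cst 0 :> (V -> W).
Proof.
move=> fd f0; apply: littleo_linear0; apply/eqoP => e e0.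
have f00 := nbhs_singleton f0; have fd' := diff_locally fd;
  have /eqaddoP/(_ _ e0) := fd'.
move: f0; apply: filterS2 => h fh; rewrite /= !fctE /= addr0 fh.
by rewrite f00 !add0r normrN.
Qed.

Lemma differentiable_affine (V W : normedModType C) (a : W) (f : {linear V -> W}) x :
  continuous f -> differentiable (fun y => a + f y) x.
Proof.
move=> fc; apply: (differentiableD (differentiable_cst a x)).
exact: linear_differentiable.
Qed.

Lemma diff_affine (V W : normedModType C) (a : W) (f : {linear V -> W}) x :
  continuous f -> 'd (fun y => a + f y) x = f :> (V -> W).
Proof.
move=> fc; apply: (diff_unique fc); apply/eqaddoP => e e0.
apply/near0P; exists 1 => [|h _]; first exact: ltr01.
rewrite [leLHS](_ : _ = 0) ?mulr_ge0 ?normr_ge0 ?ltW //.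
rewrite -[X in `|X|]/(a + f (h + x) - (a + f x + f h)) linearD [f h + _]addrC addrA.
by rewrite subrr normr0.
Qed.

Lemma differentiable_mulmx (V : normedModType C) m n p
    (X : V -> 'M[C]_(m, n)) (Y : V -> 'M[C]_(n, p)) E :
  differentiable X E -> differentiable Y E ->
  differentiable (fun E => X E *m Y E) E /\
  'd (fun E => X E *m Y E) E =
    (fun h => X E *m 'd Y E h + 'd X E h *m Y E) :> (V -> 'M[C]_(m, p)).
Proof.
move=> dX dY.
pose b : {bilinear 'M[C]_(m, n) -> 'M[C]_(n, p) -> 'M[C]_(m, p)} := @mulmx C m n p.
pose U : normedModType C := ('M[C]_(m, n) * 'M[C]_(n, p))%type.
have bc : continuous (fun z : U => b z.1 z.2).
  move=> z; apply: differentiable_continuous.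
  pose df (h : U) := z.1 *m h.2 + h.1 *m z.2.
  have dfL : linear df.
    move=> a u v; rewrite /df /= mulmxDr mulmxDl -scalemxAr -scalemxAl scalerDr.
    by rewrite addrACA.
  pose dfM := HB.pack_for {linear U -> 'M[C]_(m, p)} df
    (GRing.isLinear.Build _ _ _ _ df dfL).
  apply: (@differentiable_quadratic R U _ _ z dfM
    (n%:R * (rnorm z + rnorm z)) n%:R 1) => //.
    move=> h /=; apply: le_trans (rnormD _ _) _; rewrite mulrDr mulrDl;
      apply: lerD.
      apply: le_trans (rnorm_mulmx _ _) _; rewrite -mulrA ler_wpM2l //.
      by rewrite ler_pM ?rnorm_ge0 ?le_rnorm_fst ?le_rnorm_snd.
    apply: le_trans (rnorm_mulmx _ _) _; rewrite -mulrA ler_wpM2l // mulrC.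
    by rewrite ler_pM ?rnorm_ge0 ?le_rnorm_fst ?le_rnorm_snd.
  move=> h _ /=.
  rewrite /b /= (_ : _ - _ - _ = h.1 *m h.2).
    apply: le_trans (rnorm_mulmx _ _) _; rewrite expr2 ler_wpM2l //.
    by rewrite ler_pM ?rnorm_ge0 ?le_rnorm_fst ?le_rnorm_snd.
  rewrite mulmxDr !mulmxDl /df opprD;
    move: (z.1 *m z.2) (z.1 *m h.2) (h.1 *m z.2).
  by move=> a1 a2 a3; rewrite !addrA [LHS](ACl (4*(3*6)*(2*7)*(1*5)))/= !subrr !addr0.
have dp : differentiable (fun E => (X E, Y E)) E by apply: differentiable_pair.
have db : differentiable (fun z : 'M[C]_(m, n) * 'M[C]_(n, p) => b z.1 z.2) (X E, Y E).
  exact: differentiable_bilin.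
split; first exact: (differentiable_comp dp db).
etransitivity; first exact: (diff_comp dp db).
by rewrite diff_bilin // diff_pair.
Qed.

(** The differential at zero of [S Y = (A + E) Q], with [pr E] in place of [E] to
    cover both components of a pair. *)
Lemma diff_reduction (V : normedModType C) m n (A : 'M[C]_(m, n))
    (pr : {linear V -> 'M[C]_(m, n)}) (S : V -> 'M[C]_m) (Q : V -> 'M[C]_n)
    (Y : V -> 'M[C]_(m, n)) :
  continuous pr -> differentiable S 0 -> differentiable Q 0 -> differentiable Y 0 ->
  S 0 = 1%:M -> Q 0 = 1%:M -> Y 0 = A ->
  (\forall E \near (0 : V), S E *m Y E = (A + pr E) *m Q E) ->
  forall E, pr E = 'd S 0 E *m A - A *m 'd Q 0 E + 'd Y 0 E.
Proof.
move=> prc dS dQ dY S0 Q0 Y0 eqn E.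
have [dSY SYE] := differentiable_mulmx dS dY.
have dA := differentiable_affine A 0 prc.
have [dAQ AQE] := differentiable_mulmx dA dQ.
have dF := differentiableB dSY dAQ; have e0 := diff_eq0_near dF.
have {}e0 : 'd ((fun E => S E *m Y E) - (fun E => (A + pr E) *m Q E)) 0 E = 0.
  rewrite e0 //; move: eqn; apply: filterS => F eqF.
  by rewrite -[LHS]/(S F *m Y F - (A + pr F) *m Q F) eqF subrr.
have /= e1 := congr1 (@^~ E) (diffB dSY dAQ).
have /= e2 := congr1 (@^~ E) SYE.
have /= e3 := congr1 (@^~ E) AQE.
have /= e4 := congr1 (@^~ E) (diff_affine A 0 prc).
have e5 : A + pr 0 = A by rewrite linear0 addr0.
have key (s0 ds : 'M[C]_m) (y0 dy a0 da d1 d2 p0 : 'M[C]_(m, n)) (q0 dq : 'M[C]_n) :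
    d1 = s0 *m dy + ds *m y0 -> d2 = a0 *m dq + da *m q0 -> s0 = 1%:M ->
    q0 = 1%:M -> y0 = A -> a0 = A -> da = p0 -> d1 - d2 = 0 ->
    p0 = ds *m A - A *m dq + dy.
  move=> -> -> -> -> -> -> ->;
    rewrite mul1mx mulmx1 => /subr0_eq/(canLR (addKr _)) <-.
  by rewrite addrC [dy + _]addrC addrAC.
exact: (key _ _ _ _ _ _ _ _ _ _ _ e2 e3 S0 Q0 Y0 e5 e4 (etrans (esym e1) e0)).
Qed.

(** Differentiating the reduction of [(A + E1, B + E2)] at [E = 0]: the tangent
    space and the image of the differential of a versal deformation span
    the space of all pairs. *)
Lemma versal_tangent m n k (A B : 'M[C]_(m, n)) (D : 'rV[C]_k -> mx_pair R m n) :
  versal A B D ->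
  exists (h : {linear mx_pair R m n -> 'rV[C]_k})
         (L : {linear 'rV[C]_k -> mx_pair R m n}),
  forall E : mx_pair R m n, exists s x,
    E.1 = s *m A - A *m x + (L (h E)).1 /\ E.2 = s *m B - B *m x + (L (h E)).2.
Proof.
move=> [[Dh D0] [h [S [Q [[hh h0] [Sh S0] [Qh Q0] eqn]]]]].
have dh := nbhs_singleton hh; have dS := nbhs_singleton Sh.
have dQ := nbhs_singleton Qh.
have dD : differentiable D (h 0) by rewrite h0; exact: nbhs_singleton Dh.
have dDh := differentiable_comp dh dD.
exists ('d h 0), ('d D (h 0)) => E; exists ('d S 0 E), ('d Q 0 E).
have component (pr : {linear mx_pair R m n -> 'M[C]_(m, n)}) (M : 'M[C]_(m, n)) :
    (forall w, rnorm (pr w) <= 1 * rnorm w) -> pr (D 0) = M ->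
    (\forall E \near (0 : mx_pair R m n), S E *m pr (D (h E)) = (M + pr E) *m Q E) ->
    pr E = 'd S 0 E *m M - M *m 'd Q 0 E + pr ('d D (h 0) ('d h 0 E)).
  move=> /rnorm_bound_continuous prc prM eqM.
  have dpr : differentiable pr ((D \o h) 0) by apply: linear_differentiable.
  have dY := differentiable_comp dDh dpr.
  have Y0 : (pr \o (D \o h)) 0 = M by rewrite /= h0.
  have -> := diff_reduction prc dS dQ dY S0 Q0 Y0 eqM E.
  have -> : 'd (pr \o (D \o h)) 0 E = pr ('d (D \o h) 0 E).
    have -> := congr1 (@^~ E) (diff_comp dDh dpr).
    exact: (congr1 (@^~ _) (diff_lin _ prc)).
  by have -> := congr1 (@^~ E) (diff_comp dh dD).
have uS := near_unitmx dS S0.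
split.
  pose f (w : mx_pair R m n) := w.1.
  have fL : linear f by [].
  apply: (component (HB.pack_for {linear mx_pair R m n -> 'M[C]_(m, n)} f
    (GRing.isLinear.Build _ _ _ _ f fL))) => [w||] /=.
  - by rewrite mul1r; apply: le_rnorm_fst.
  - by rewrite D0.
  - by move: eqn uS; apply: filterS2 => F -> uS; rewrite /f /= -mulmxA mulKVmx.
pose f (w : mx_pair R m n) := w.2.
have fL : linear f by [].
apply: (component (HB.pack_for {linear mx_pair R m n -> 'M[C]_(m, n)} f
  (GRing.isLinear.Build _ _ _ _ f fL))) => [w||] /=.
- by rewrite mul1r; apply: le_rnorm_snd.
- by rewrite D0.
- by move: eqn uS; apply: filterS2 => F -> uS; rewrite /f /= -mulmxA mulKVmx.
Qed.

(** If the differential [h] of the parameters annihilates a star-supported pair,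
    this pair is tangent to the orbit, hence zero. So [h] embeds the space of
    star-supported pairs in the space of parameters of [D']. *)
Lemma complement_minimal m n k (A B : 'M[C]_(m, n)) SP SQ
    (P : {linear 'rV[C]_k -> mx_pair R m n}) k' (D' : 'rV[C]_k' -> mx_pair R m n) :
  complement A B A B SP SQ -> injective P ->
  (forall a, supported SP (P a).1 /\ supported SQ (P a).2) ->
  versal A B D' -> (k <= k')%N.
Proof.
move=> [_ un] PI PS /versal_tangent[h [L hL]].
have hP0 a : h (P a) = 0 -> a = 0.
  move=> ha; have [s [x [E1 E2]]] := hL (P a).
  move: E1 E2; rewrite ha linear0 !addr0 => E1 E2.
  have [P1 P2] := PS a; rewrite E1 in P1; rewrite E2 in P2.
  have [e1 e2] := un _ _ P1 P2; apply: PI; rewrite linear0.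
  by apply: injective_projections; rewrite /= ?E1 ?E2 ?e1 ?e2 subrr.
have free : row_free (lin1_mx (h \o P)).
  rewrite -kermx_eq0; apply/rowV0P => v /sub_kermxP; rewrite mul_rV_lin1.
  exact: hP0.
by rewrite -(eqP free) rank_leq_col.
Qed.

(** The parameters are numbered by an enumeration of the stars, and the pair
    [rho w] of star-supported matrices is recorded by its entries [c w] there. *)
Theorem complement_star_miniversal m n (A B : 'M[C]_(m, n)) SP SQ :
  complement A B A B SP SQ ->
  exists k (D : 'rV[C]_k -> mx_pair R m n),
    [/\ star_deformation A B SP SQ D, deformation A B D & miniversal A B D].
Proof.
move=> cmp.
pose X := finset (fun z : ('I_m * 'I_n) + ('I_m * 'I_n) =>
  match z with inl (i, j) => SP i j | inr (i, j) => SQ i j end).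
pose pos (t : 'I_#|X|) := enum_val t.
pose P (a : 'rV[C]_#|X|) : mx_pair R m n :=
  (\matrix_(i, j) \sum_(t < #|X| | pos t == inl (i, j)) a 0 t,
   \matrix_(i, j) \sum_(t < #|X| | pos t == inr (i, j)) a 0 t).
have PL : linear P.
  move=> a u v; apply: injective_projections; apply/matrixP=> i j;
    rewrite !mxE mulr_sumr -big_split /=; apply: eq_bigr => t _;
      by rewrite !mxE.
pose PM := HB.pack_for {linear 'rV[C]_#|X| -> mx_pair R m n} P
  (GRing.isLinear.Build _ _ _ _ P PL).
have posI : injective pos by exact: enum_val_inj.
have posX z : (z \in codom pos) = (z \in X).
  apply/codomP/idP => [[t ->]|zX]; first exact: enum_valP.
  by exists (enum_rank_in zX z); rewrite /pos enum_rankK_in.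
pose val (w : mx_pair R m n) z : C :=
  match z with inl (i, j) => w.1 i j | inr (i, j) => w.2 i j end.
have valPE a z : val (P a) z = \sum_(t < #|X| | pos t == z) a 0 t.
  by case: z => [[i j]|[i j]]; rewrite /val /P mxE.
have PK a t : val (P a) (pos t) = a 0 t.
  by rewrite valPE (big_pred1 t) // => t'; rewrite /= (inj_eq posI).
have val_out a z : z \notin X -> val (P a) z = 0.
  move=> zX; rewrite valPE big1 // => t /eqP tz.
  by move: zX; rewrite -tz enum_valP.
have Psupp a : supported SP (P a).1 /\ supported SQ (P a).2.
  by split=> i j Sij; [apply: (val_out a (inl (i, j))) | apply: (val_out a (inr (i, j)))];
    rewrite inE.
have valK w : supported SP w.1 -> supported SQ w.2 -> P (\row_t val w (pos t)) = w.
  move=> sP sQ; have E z : val (P (\row_t val w (pos t))) z = val w z.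
    have [|zX] := boolP (z \in X).
      by rewrite -posX => /codomP[t ->]; rewrite PK mxE.
    by rewrite val_out //; move: zX; rewrite inE;
      case: z => [[i j]|[i j]] => [/sP|/sQ].
  apply: injective_projections; apply/matrixP=> i j;
    [exact: (E (inl (i, j))) | exact: (E (inr (i, j)))].
pose D a : mx_pair R m n := (A + (P a).1, B + (P a).2).
exists #|X|, D.
have Dd : deformation A B D.
  have P0 : P 0 = 0 := linear0 PM.
  split; last by rewrite /D P0 /= !addr0.
  have [k _ /rnorm_bound_continuous Pc] := linear_rV_bounded PM.
  apply/near0P; exists 1; first exact: ltr01.
  by move=> a _; apply: (differentiable_affine ((A, B) : mx_pair R m n) a Pc).
split=> //.
  exists pos; split=> //.
  - by move=> i j; rewrite posX inE.
  - by move=> i j; rewrite posX inE.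
  - by apply/near0P; exists 1.
split; last first.
  move=> k' D'; apply: (complement_minimal (P := PM) cmp _ Psupp).
  by move=> a a' E; apply/rowP => t; rewrite -!PK; congr val; exact: E.
split=> //.
have [g [s [x [rho [[gh g0] Sh Qh rhoS E]]]]] := complement_versal cmp.
pose c w : 'rV[C]_#|X| := \row_t val (rho w) (pos t).
have cL : linear c.
  move=> a u v; apply/rowP=> t; rewrite !mxE (linearP rho).
  by case: (pos t) => [[i j]|[i j]]; rewrite /= !mxE.
pose cM := HB.pack_for {linear mx_pair R m n -> 'rV[C]_#|X|} c
  (GRing.isLinear.Build _ _ _ _ c cL).
exists (c \o g), (fun E => 1%:M + s (g E)), (fun E => 1%:M + x (g E));
  split => //.
- have c0 : c 0 = 0 := linear0 cM.
  split; last by rewrite /= g0 c0.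
  have [k _ ck] := linear_mx_pair_bounded cM.
  move: gh; rewrite /holomorphic_at0; apply: filterS => F gd.
  apply: (differentiable_comp gd); apply: (@linear_differentiable _ _ _ cM).
  exact: rnorm_bound_continuous ck.
have cK w : P (c w) = rho w by case: (rhoS w); apply: valK.
by move: E; apply: filterS => F <-; rewrite -(cK (g F)).
Qed.

End Minimality.

(** * Strips of the Weyr partition *)

Section Strips.
Local Open Scope nat_scope.

Lemma reshape_index_cons n sh i :
  reshape_index (n :: sh) i = if i < n then 0 else (reshape_index sh (i - n)).+1.
Proof.
by rewrite /reshape_index /= subn_eq0; case: ltnP => // ni; rewrite subSn.
Qed.

Lemma reshape_index_cat sh1 sh2 i :
  reshape_index (sh1 ++ sh2) i = if i < sumn sh1 then reshape_index sh1 i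
    else size sh1 + reshape_index sh2 (i - sumn sh1).
Proof.
elim: sh1 i => [|n sh1 IHsh1] i; first by rewrite subn0.
rewrite /= !reshape_index_cons IHsh1; case: ltnP => ni.
  by rewrite (leq_trans ni) ?leq_addr.
by rewrite ltn_subLR // subnDA; case: ifP; rewrite ?addSn.
Qed.

Lemma reshape_index_flatten (shs : seq (seq nat)) c z :
  c < size shs -> z < sumn (nth [::] shs c) ->
  reshape_index (flatten shs) (sumn (map sumn (take c shs)) + z) =
  sumn (map size (take c shs)) + reshape_index (nth [::] shs c) z.
Proof.
elim: shs c => // sh shs IHshs [|c] /=; rewrite reshape_index_cat.
  by move=> _ zc; rewrite !add0n zc.
rewrite ltnS => cs zc; rewrite ltnNge -addnA leq_addr /= addKn IHshs //.
by rewrite addnA.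
Qed.

(** When a word is cut into constant runs, one for each of some pairwise distinct
    keys, the number of the run at a position is the rank of its key among
    the keys that occur. *)
Lemma reshape_index_runs (T : eqType) (x0 : T) (kc : seq (T * nat)) i :
  uniq (unzip1 kc) ->
  let word := flatten [seq nseq z.2 z.1 | z <- kc] in
  i < size word ->
  let keys := unzip1 [seq z <- kc | 0 < z.2] in
  nth x0 word i \in keys /\
  reshape_index [seq d <- unzip2 kc | 0 < d] i = index (nth x0 word i) keys.
Proof.
move=> kcU word iw keys.
pose ss := [seq nseq z.2 z.1 | z <- [seq z <- kc | 0 < z.2]].
have wordE : word = flatten ss.
  rewrite /word /ss; elim: (kc) => //= -[k [|d]] kc' IH /=; first exact: IH.
  by rewrite IH.
have shE : [seq d <- unzip2 kc | 0 < d] = shape ss.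
  rewrite /ss /unzip2 filter_map /shape -!map_comp.
  by apply: eq_map => z /=; rewrite size_nseq.
have keysU : uniq keys.
  by rewrite /keys; apply: subseq_uniq kcU; apply/map_subseq/filter_subseq.
have ish : i < sumn (shape ss) by rewrite -size_flatten -wordE.
rewrite shE wordE nth_flatten; set r := reshape_index _ _.
have rs : r < size [seq z <- kc | 0 < z.2].
  by have := reshape_indexP ish; rewrite !size_map.
have := reshape_offsetP ish; rewrite -/r.
rewrite (nth_map [::]) ?size_map // (nth_map (x0, 0)) // size_nseq => off.
rewrite nth_nseq off.
rewrite -(nth_map _ x0 fst rs) -/keys.
have rk : r < size keys by rewrite size_map.
by rewrite mem_nth // index_uniq.
Qed.

Lemma pairwise_rev (T : Type) (e : rel T) s :
  pairwise e (rev s) = pairwise (fun x y => e y x) s.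
Proof.
by elim: s => //= x s <-; rewrite rev_cons pairwise_rcons all_rev.
Qed.

Lemma iota_le a b m : b \in iota a (m.+1 - a) -> a <= b /\ b <= m.
Proof. by rewrite mem_iota; lia. Qed.

Section Weyr.
Variables (t : nat) (ns : 'I_t -> nat).
Hypothesis ns_mono : forall i j : 'I_t, i <= j -> ns j <= ns i.

Local Notation N := (\sum_i ns i).
Local Notation k := (\max_(i < t) ns i).

(** Position [a] of a Jordan block of size [b]; these numbers are ordered by
    increasing [a] first and by decreasing [b <= k] next. *)
Let code a b := a * k.+1 + (k - b).

Let code_lt a b a' b' : b <= k -> b' <= k ->
  (code a b < code a' b') = (a < a') || ((a == a') && (b' < b)).
Proof.
rewrite /code; move: (\max_(i < t) ns i) => K bk b'k.
case: (ltngtP a a') => [aa|aa|->] /=; last by lia.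
  have : a.+1 * K.+1 <= a' * K.+1 by rewrite leq_mul.
  by lia.
have : a'.+1 * K.+1 <= a * K.+1 by rewrite leq_mul.
by lia.
Qed.

Let ns_max i : ns i <= k. Proof. exact: (leq_bigmax i). Qed.

Let key (z : 'I_N) := code (tagnat.sig2 z).+1 (ns (tagnat.sig1 z)).

Let key_lt z z' : (key z < key z') =
  (tagnat.sig2 z < tagnat.sig2 z') ||
  ((tagnat.sig2 z == tagnat.sig2 z' :> nat) &&
   (ns (tagnat.sig1 z') < ns (tagnat.sig1 z))).
Proof. by rewrite code_lt // ltnS eqSS. Qed.

(** The numbers of Jordan blocks of size [b] are the differences of these. *)
Let count_ge b := #|[set i : 'I_t | b <= ns i]|.

Let pairs := [seq (a, b) | a <- iota 1 k, b <- rev (iota a (k.+1 - a))].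

Let runs := [seq (code z.1 z.2, count_ge z.2 - count_ge z.2.+1) | z <- pairs].

Let weyr_partitionE : weyr_partition ns = [seq d <- unzip2 runs | 0 < d].
Proof.
rewrite /weyr_partition /runs /unzip2 -map_comp /pairs.
congr [seq d <- _ | 0 < d]; rewrite map_flatten -map_comp; congr flatten;
  apply: eq_map => a /=.
by rewrite -map_comp.
Qed.

Let runs_sorted : sorted ltn (unzip1 runs).
Proof.
rewrite /unzip1 -map_comp (sorted_pairwise ltn_trans) pairwise_map.
have : all (fun a => 0 < a) (iota 1 k) && sorted ltn (iota 1 k).
  by rewrite iota_ltn_sorted andbT; apply/allP => a;
    rewrite mem_iota => /andP[].
rewrite (sorted_pairwise ltn_trans) /pairs; elim: (iota 1 k) => //= a s IHs.
move=> /andP[/andP[a0 s0] /andP[as_ ss]]; rewrite pairwise_cat.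
rewrite IHs ?s0 // andbT; apply/andP; split.
  apply/allrelP => _ [a' b'] /mapP[b + ->] /allpairsPdep[a1 [b1 [a1s + [-> ->]]]].
  rewrite !mem_rev => /iota_le[_ bk] /iota_le[_ b1k].
  have aa1 : a < a1 by have /allP/(_ _ a1s) := as_.
  by rewrite /= code_lt ?aa1.
rewrite pairwise_map pairwise_rev.
apply: (@sub_in_pairwise _ (fun b => b <= k) ltn); last first.
- by rewrite -(sorted_pairwise ltn_trans) iota_ltn_sorted.
- by apply/allP => b /iota_le[].
by move=> b b' bk b'k /= bb'; rewrite code_lt // eqxx bb' orbT.
Qed.

Let word := [seq key z | z <- weyr_order ns].

(** The Weyr order is sorted by [key] because the sizes of the blocks decrease. *)
Let word_sorted : sorted leq word.
Proof.
apply: homo_sorted (sort_sorted _ _) => [x y xy|x y].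
  rewrite leqNgt key_lt; apply/negP; case/orP: xy => [xy|/andP[/eqP -> xy]].
    by lia.
  by have := ns_mono xy; lia.
by case: ltngtP => //= _; lia.
Qed.

Let count_geE b : count_ge b - count_ge b.+1 = \sum_(i < t) (ns i == b).
Proof.
have E c : count_ge c = \sum_(i < t) (c <= ns i).
  rewrite /count_ge -sum1_card big_mkcond; apply: eq_bigr => i _.
  have -> : (i \in [set j : 'I_t | c <= ns j])%classic = (c <= ns i).
    by apply/idP/idP => [/set_mem //|ci]; apply/mem_set.
  by case: leqP.
rewrite !E; have -> : \sum_(i < t) (b <= ns i) =
    \sum_(i < t) (ns i == b) + \sum_(i < t) (b.+1 <= ns i).
  by rewrite -big_split; apply: eq_bigr => i _ /=; case: (ltngtP (ns i) b).
by rewrite addnK.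
Qed.

Let count_word P : count P word = \sum_(i < t) \sum_(j < ns i) P (code j.+1 (ns i)).
Proof.
rewrite -sum1_count big_map (perm_big (enum 'I_N)) ?perm_sort //=.
rewrite big_mkcond big_enum /= sig_big_dep/= (reindex _ tagnat.sig_bij_on)/=.
by apply: eq_bigr => z _; rewrite /key /tagnat.sig1 /tagnat.sig2; case: (P _).
Qed.

Let count_runs P :
  count P (flatten [seq nseq z.2 z.1 | z <- runs]) = count P word.
Proof.
rewrite count_word count_flatten sumnE !big_map /pairs.
rewrite big_allpairs_dep /=.
under eq_bigr => a _ do rewrite big_rev.
have E a : \sum_(b <- iota a (k.+1 - a))
    count P (nseq (count_ge b - count_ge b.+1) (code a b)) =
    \sum_(i < t) (a <= ns i) * P (code a (ns i)).
  rewrite -/(index_iota a k.+1).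
  under eq_bigr => b _ do rewrite count_nseq count_geE big_distrr /=.
  rewrite exchange_big; apply: eq_bigr => i _ /=.
  rewrite (eq_bigr (fun b => if b == ns i then P (code a b) : nat else 0)).
    rewrite -big_mkcond big_nat1_eq ltnS ns_max andbT.
    by case: (a <= ns i); rewrite ?mul1n.
  by move=> b _; rewrite eq_sym; case: eqP; rewrite ?muln1 ?muln0.
under eq_bigr => a _ do rewrite E.
rewrite exchange_big; apply: eq_bigr => i _ /=.
have -> : iota 1 k = index_iota 1 k.+1 by rewrite /index_iota subn1.
rewrite (eq_bigr (fun a => if a < (ns i).+1 then P (code a (ns i)) : nat else 0)).
  rewrite -big_mkcond -(big_nat_widen 1 (ns i).+1 k.+1 predT) ?ltnS //.
  by rewrite big_add1 big_mkord.
by move=> a _; rewrite ltnS; case: leqP; rewrite ?mul1n ?mul0n.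
Qed.

(** Both words are sorted and contain every key equally often. *)
Let wordE : word = flatten [seq nseq z.2 z.1 | z <- runs].
Proof.
apply: (sorted_eq leq_trans anti_leq) => //; last first.
  by apply/permP => P; rewrite count_runs.
rewrite (sorted_pairwise leq_trans).
move: runs_sorted; rewrite (sorted_pairwise ltn_trans).
elim: (runs) => //= -[x d] rs IHrs /andP[xrs /IHrs {}IHrs].
rewrite pairwise_cat IHrs andbT; apply/andP; split.
  apply/allrelP => _ z /nseqP[-> _] /flatten_mapP[y yrs /nseqP[-> _]].
  by have /allP/(_ _ (map_f fst yrs)) := xrs; apply: ltnW.
by elim: d {xrs} => //= d ->; rewrite andbT; apply/allP => z /nseqP[->].
Qed.

Lemma sumn_weyr_partition : sumn (weyr_partition ns) = N.
Proof.
rewrite weyr_partitionE -(size_weyr_order ns) -(size_map key) -/word wordE.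
rewrite size_flatten /shape -map_comp;
  elim: (runs) => //= -[x [|d]] rs IHrs //=.
by rewrite IHrs size_nseq.
Qed.

Let key_strip (x : 'I_N) (keys := unzip1 [seq z <- runs | 0 < z.2]) :
  key (weyr_index x) \in keys /\
  reshape_index (weyr_partition ns) x = index (key (weyr_index x)) keys.
Proof.
have xw : x < size word by rewrite size_map size_weyr_order.
have -> : key (weyr_index x) = nth 0 word x.
  by rewrite (nth_map x) ?size_weyr_order.
rewrite weyr_partitionE wordE; apply: reshape_index_runs;
  last by rewrite -wordE.
exact: sorted_uniq ltn_trans ltnn _ runs_sorted.
Qed.

Lemma weyr_strip_lt (x y : 'I_N) :
  reshape_index (weyr_partition ns) x < reshape_index (weyr_partition ns) y ->
  key (weyr_index x) < key (weyr_index y).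
Proof.
have [xk ->] := key_strip x; have [yk ->] := key_strip y.
apply: (sorted_ltn_index ltn_trans) => //.
by apply: (subseq_sorted ltn_trans _ runs_sorted);
  apply/map_subseq/filter_subseq.
Qed.

Lemma weyr_strip_eq (x y : 'I_N) :
  reshape_index (weyr_partition ns) x = reshape_index (weyr_partition ns) y ->
  key (weyr_index x) = key (weyr_index y).
Proof.
have [xk ->] := key_strip x; have [yk ->] := key_strip y.
by move/(congr1 (nth 0 (unzip1 [seq z <- runs | 0 < z.2]))); rewrite !nth_index.
Qed.

Let code_inj a b a' b' : b <= k -> b' <= k -> code a b = code a' b' -> a = a' /\ b = b'.
Proof.
move=> bk b'k E; have := code_lt a a' bk b'k; have := code_lt a' a b'k bk.
by rewrite E ltnn; lia.
Qed.

(** The stars of the deformed Weyr matrix form whole blocks, on or below the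
    diagonal of the partition. *)
Lemma weyr_stars_strips (x x' y y' : 'I_N) :
  reshape_index (weyr_partition ns) x = reshape_index (weyr_partition ns) x' ->
  reshape_index (weyr_partition ns) y = reshape_index (weyr_partition ns) y' ->
  weyr_stars ns x y = weyr_stars ns x' y'.
Proof.
move=> /weyr_strip_eq/code_inj[//|//|[a1] b1] /weyr_strip_eq/code_inj[//|//|[a2] b2].
by rewrite !mxE a1 b1 a2 b2.
Qed.

Lemma weyr_stars_lower (x y : 'I_N) : weyr_stars ns x y ->
  reshape_index (weyr_partition ns) y <= reshape_index (weyr_partition ns) x.
Proof.
rewrite leqNgt => S; apply/negP => /weyr_strip_lt; apply/negP; rewrite key_lt.
move: S; rewrite !mxE.
have := ltn_ord (tagnat.sig2 (weyr_index x)).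
have := ltn_ord (tagnat.sig2 (weyr_index y)).
set a := nat_of_ord (tagnat.sig2 _); set b := nat_of_ord (tagnat.sig2 _).
set m := ns _; set m' := ns _.
move=> Hb Ha; case: (ltnP m' m) => mm; lia.
Qed.

End Weyr.
End Strips.

(** * Block triangularity *)

Section Labels.
Local Open Scope nat_scope.

Lemma RankP (l : nat) (p : 'I_l -> nat) (x : 'I_(\sum_i p i)) :
  exists i (c : 'I_(p i)), x = tagnat.Rank i c.
Proof. by exists (tagnat.sig1 x), (tagnat.sig2 x); rewrite tagnat.sig2K. Qed.

Lemma mxblock_Rank (T : Type) (l r : nat) (p : 'I_l -> nat) (q : 'I_r -> nat)
    (B : forall i j, 'M[T]_(p i, q j)) i j (a : 'I_(p i)) (b : 'I_(q j)) :
  (\mxblock_(i, j) B i j) (tagnat.Rank i a) (tagnat.Rank j b) = B i j a b.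
Proof. by have := congr1 (fun M : 'M[T]_(p i, q j) => M a b) (mxblockK B i j);
  rewrite [LHS]mxE. Qed.

Lemma sumn_take_enum l (f : 'I_l -> nat) i :
  sumn (take i [seq f j | j <- enum 'I_l]) = \sum_(j < l | j < i) f j.
Proof.
have -> : take i [seq f j | j <- enum 'I_l] =
    map f (seq.filter (fun j : 'I_l => j < i) (enum 'I_l)).
  rewrite -map_take; congr map; apply: (inj_map val_inj).
  rewrite map_take val_enum_ord take_iota -(filter_map val (fun j => j < i)).
  rewrite val_enum_ord; case: (leqP i l) => il.
    exact: esym (filter_iota_ltn 0 il).
  rewrite (eq_in_filter (a2 := predT)) ?filter_predT //.
  by move=> j; rewrite mem_iota /= => jl; rewrite (leq_trans jl) // ltnW.
by rewrite sumnE big_map big_filter big_enum_cond.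
Qed.

Lemma sumn_enum l (f : 'I_l -> nat) :
  sumn [seq f j | j <- enum 'I_l] = \sum_j f j.
Proof. by rewrite sumnE big_map big_enum. Qed.

Lemma nth_map_enum T (z : T) l (f : 'I_l -> T) (i : 'I_l) :
  nth z [seq f j | j <- enum 'I_l] i = f i.
Proof. by rewrite (nth_map i) ?size_enum_ord // nth_ord_enum. Qed.

Lemma sumn_take_le s i j : i < j -> i < size s ->
  sumn (take i s) + nth 0 s i <= sumn (take j s).
Proof.
move=> ij si; rewrite -(subnKC ij) takeD sumn_cat (take_nth 0 si) sumn_rcons.
exact: leq_addr.
Qed.

(** * Strips for several eigenvalues *)

Section WeyrSum.
Variables (tau : nat) (t : 'I_tau -> nat) (nJ : forall c : 'I_tau, 'I_(t c) -> nat).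
Hypothesis nJ_mono : forall c (i j : 'I_(t c)), i <= j -> nJ j <= nJ i.

Let shs := [seq weyr_partition (@nJ c) | c <- enum 'I_tau].
Let off c := sumn (map size (take c shs)).
Let strip c := reshape_index (weyr_partition (@nJ c)).

Let nth_shs (c : 'I_tau) : nth [::] shs c = weyr_partition (@nJ c).
Proof. exact: nth_map_enum. Qed.

Let size_shs : size shs = tau.
Proof. by rewrite size_map size_enum_ord. Qed.

Local Notation RankN := (@tagnat.Rank tau (fun c => \sum_i @nJ c i)).

Let strip_Rank c (z : 'I_(\sum_i @nJ c i)) :
  reshape_index (flatten shs) (RankN c z) = off c + strip c z.
Proof.
rewrite tagnat.RankEsum -sumn_take_enum.
have -> : [seq \sum_i @nJ c i | c <- enum 'I_tau] = map sumn shs.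
  rewrite /shs -map_comp; apply: eq_map => d /=.
  by rewrite sumn_weyr_partition //; apply: nJ_mono.
rewrite -map_take reshape_index_flatten ?size_shs //; first by rewrite nth_shs.
by rewrite nth_shs sumn_weyr_partition //; apply: nJ_mono.
Qed.

(** The strips of one eigenvalue are numbered after all those of the previous
    ones. *)
Let strip_inj c c' (z : 'I_(\sum_i @nJ c i)) (z' : 'I_(\sum_i @nJ c' i)) :
  off c + strip c z = off c' + strip c' z' -> c = c'.
Proof.
have sz d (y : 'I_(\sum_i @nJ d i)) : off d + strip d y < off d + nth 0 (map size shs) d.
  rewrite ltn_add2l (nth_map [::]) ?size_shs // nth_shs.
  by apply: reshape_indexP; rewrite sumn_weyr_partition //; apply: nJ_mono.
have le d d' : d < d' -> d < tau -> off d + nth 0 (map size shs) d <= off d'.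
  move=> dd' dt; rewrite /off !map_take; apply: sumn_take_le => //.
  by rewrite size_map size_shs.
have := sz c z; have := sz c' z'; have := le c c'; have := le c' c.
move=> l1 l2 s1 s2 E; apply: val_inj => /=.
case: (ltngtP c c') => // cc;
  [have := l2 cc (ltn_ord c) | have := l1 cc (ltn_ord c')];
  lia.
Qed.

Let S := dsum false (fun c => weyr_stars (@nJ c)).

Lemma dsum_weyr_stars_strips (x x' y y' : 'I_(\sum_c \sum_i @nJ c i)) :
  reshape_index (flatten shs) x = reshape_index (flatten shs) x' ->
  reshape_index (flatten shs) y = reshape_index (flatten shs) y' ->
  S x y = S x' y'.
Proof.
have [c [a ->]] := RankP x; have [c' [a' ->]] := RankP x'.
have [d [b ->]] := RankP y; have [d' [b' ->]] := RankP y'.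
rewrite !strip_Rank => ca db; have cc := strip_inj ca; have dd := strip_inj db.
case: _ / cc in a' ca *; case: _ / dd in b' db *.
rewrite /S /dsum !mxblock_Rank; case: eqP => [cd|_]; last by rewrite !mxE.
case: _ / cd in b b' db *; rewrite conform_mx_id.
apply: weyr_stars_strips; first exact: nJ_mono.
  exact: addnI ca.
exact: addnI db.
Qed.

Lemma dsum_weyr_stars_lower (x y : 'I_(\sum_c \sum_i @nJ c i)) : S x y ->
  reshape_index (flatten shs) y <= reshape_index (flatten shs) x.
Proof.
have [c [a ->]] := RankP x; have [d [b ->]] := RankP y.
rewrite !strip_Rank /S /dsum mxblock_Rank; case: eqP => [cd|_];
  last by rewrite mxE.
case: _ / cd in b *; rewrite conform_mx_id leq_add2l.
by apply: weyr_stars_lower; apply: nJ_mono.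
Qed.

End WeyrSum.

(** * Labels of the rows and columns *)

Section Label.
Variables (l r : nat) (a : 'I_l -> nat) (b : 'I_r -> nat) (n n' : nat).
Variables (wJ wJ0 : seq nat).

Local Notation dim := ((\sum_i a i) + (n + (n' + \sum_i b i))).

Let sizes := [seq a i | i <- enum 'I_l] ++ [:: n;
  n'] ++ [seq b i | i <- enum 'I_r].

Definition indexL (y : 'I_(\sum_i a i)) : 'I_dim := lshift _ y.
Definition indexJ (y : 'I_n) : 'I_dim := rshift _ (lshift _ y).
Definition indexN (y : 'I_n') : 'I_dim := rshift _ (rshift _ (lshift _ y)).
Definition indexR (y : 'I_(\sum_i b i)) : 'I_dim := rshift _ (rshift _ (rshift _ y)).

Let lab (x : 'I_dim) := label sizes l wJ wJ0 x.

Let labelE s o (x : 'I_dim) : x = flatten_index sizes s o :> nat ->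
  o < nth 0 sizes s ->
  lab x = (s, if s == l then reshape_index wJ o
              else if s == l.+1 then reshape_index wJ0 o else o).
Proof. by move=> xE os;
  rewrite /lab /label xE flatten_indexKl // flatten_indexKr. Qed.

Let size_l : size [seq a i | i <- enum 'I_l] = l.
Proof. by rewrite size_map size_enum_ord. Qed.

Let sum_l : sumn [seq a i | i <- enum 'I_l] = \sum_i a i.
Proof. exact: sumn_enum. Qed.

Let index_l k o : flatten_index sizes (l + k) o =
  \sum_i a i + flatten_index ([:: n; n'] ++ [seq b i | i <- enum 'I_r]) k o.
Proof.
rewrite /flatten_index /sizes take_cat size_l ltnNge leq_addr /= addKn sumn_cat sum_l.
by rewrite addnA.
Qed.

Let nth_l k : nth 0 sizes (l + k) =
  nth 0 ([:: n; n'] ++ [seq b i | i <- enum 'I_r]) k.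
Proof. by rewrite /sizes nth_cat size_l ltnNge leq_addr /= addKn. Qed.

Lemma label_indexL i (c : 'I_(a i)) :
  lab (indexL (tagnat.Rank i c)) = (nat_of_ord i, nat_of_ord c).
Proof.
rewrite (@labelE i c).
- by rewrite (ltn_eqF (ltn_ord i)) (ltn_eqF (leqW (ltn_ord i))).
- rewrite -[LHS]/(nat_of_ord (tagnat.Rank i c)) tagnat.RankEsum.
  by rewrite /flatten_index take_cat size_l ltn_ord sumn_take_enum.
- by rewrite nth_cat size_l ltn_ord nth_map_enum.
Qed.

Lemma label_indexJ y : lab (indexJ y) = (l, reshape_index wJ y).
Proof.
rewrite (@labelE (l + 0) y); last 2 first.
- by rewrite index_l.
- by rewrite nth_l.
by rewrite addn0 eqxx.
Qed.

Lemma label_indexN y : lab (indexN y) = (l.+1, reshape_index wJ0 y).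
Proof.
rewrite (@labelE (l + 1) y); last 2 first.
- by rewrite index_l /flatten_index /= addn0.
- by rewrite nth_l.
by rewrite addn1 eqxx gtn_eqF.
Qed.

Lemma label_indexR i (c : 'I_(b i)) :
  lab (indexR (tagnat.Rank i c)) = (l + i.+2, nat_of_ord c).
Proof.
rewrite (@labelE (l + i.+2) c); last 2 first.
- rewrite index_l /flatten_index -[LHS]/(\sum_i a i + (n + (n' + tagnat.Rank i c))).
  by rewrite tagnat.RankEsum -sumn_take_enum /= !addnA.
- by rewrite nth_l /= nth_map_enum.
by rewrite !gtn_eqF //; lia.
Qed.

Lemma indexP (x : 'I_dim) : [\/ exists y, x = indexL y, exists y, x = indexJ y,
  exists y, x = indexN y | exists y, x = indexR y].
Proof.
case: (split_ordP x) => [y ->|x1 ->]; first by constructor 1; exists y.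
case: (split_ordP x1) => [y ->|x2 ->]; first by constructor 2; exists y.
case: (split_ordP x2) => [y ->|y ->]; first by constructor 3; exists y.
by constructor 4; exists y.
Qed.

(** Outside of the two square summands a label determines its row or column. *)
Lemma label_eq x x' : lab x = lab x' ->
  [\/ x = x',
      exists y y', [/\ x = indexJ y, x' = indexJ y' & reshape_index wJ y = reshape_index wJ y']
    | exists y y', [/\ x = indexN y, x' = indexN y' & reshape_index wJ0 y = reshape_index wJ0 y']].
Proof.
have Lx (i : 'I_l) := ltn_ord i.
case: (indexP x) => -[y ->]; case: (indexP x') => -[y' ->];
  try (have [i [c ->]] := RankP y); try (have [i' [c' ->]] := RankP y');
  rewrite ?label_indexL ?label_indexJ ?label_indexN ?label_indexR => E;
  have /= e1 := congr1 fst E; have /= e2 := congr1 snd E; clear E;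
  try (exfalso; move: e1; try have := Lx i; try have := Lx i'; lia).
- constructor 1; have ii : i = i' by apply: val_inj.
  by case: _ / ii in c' e2 *; congr (indexL (tagnat.Rank _ _)); apply: val_inj.
- by constructor 2; exists y, y'.
- by constructor 3; exists y, y'.
- constructor 1; have ii : i = i' by apply: val_inj; move: e1 => /=; lia.
  by case: _ / ii in c' e2 *; congr (indexR (tagnat.Rank _ _)); apply: val_inj.
Qed.

End Label.

Section Patterns.
Variables (l r : nat) (p : 'I_l -> nat) (q : 'I_r -> nat) (n n' : nat).
Variables (wJ wJ0 : seq nat).

Local Notation rl := (@row_label l r p q n n' wJ wJ0).
Local Notation cl := (@col_label l r p q n n' wJ wJ0).
Local Notation rdim := (rows_dim p q n n').
Local Notation cdim := (cols_dim p q n n').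

Let rL (i : 'I_(\sum_i (p i).-1)) : 'I_rdim := @indexL l r (fun i => (p i).-1) q n n' i.
Let rJ (i : 'I_n) : 'I_rdim := @indexJ l r (fun i => (p i).-1) q n n' i.
Let rN (i : 'I_n') : 'I_rdim := @indexN l r (fun i => (p i).-1) q n n' i.
Let rR (i : 'I_(\sum_i q i)) : 'I_rdim := @indexR l r (fun i => (p i).-1) q n n' i.
Let cL (i : 'I_(\sum_i p i)) : 'I_cdim := @indexL l r p (fun i => (q i).-1) n n' i.
Let cJ (i : 'I_n) : 'I_cdim := @indexJ l r p (fun i => (q i).-1) n n' i.
Let cN (i : 'I_n') : 'I_cdim := @indexN l r p (fun i => (q i).-1) n n' i.
Let cR (i : 'I_(\sum_i (q i).-1)) : 'I_cdim := @indexR l r p (fun i => (q i).-1) n n' i.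

Let rowP (x : 'I_rdim) : [\/ exists y, x = rL y, exists y, x = rJ y,
  exists y, x = rN y | exists y, x = rR y].
Proof. exact: indexP. Qed.

Let colP (x : 'I_cdim) : [\/ exists y, x = cL y, exists y, x = cJ y,
  exists y, x = cN y | exists y, x = cR y].
Proof. exact: indexP. Qed.

Let rl_eq x x' : rl x = rl x' ->
  [\/ x = x',
      exists y y', [/\ x = rJ y, x' = rJ y' & reshape_index wJ y = reshape_index wJ y']
    | exists y y', [/\ x = rN y, x' = rN y' & reshape_index wJ0 y = reshape_index wJ0 y']].
Proof. exact: label_eq. Qed.

Let cl_eq x x' : cl x = cl x' ->
  [\/ x = x',
      exists y y', [/\ x = cJ y, x' = cJ y' & reshape_index wJ y = reshape_index wJ y']
    | exists y y', [/\ x = cN y, x' = cN y' & reshape_index wJ0 y = reshape_index wJ0 y']].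
Proof. exact: label_eq. Qed.

Let rl_L i (c : 'I_(p i).-1) :
  rl (rL (@tagnat.Rank _ (fun i => (p i).-1) i c)) = (nat_of_ord i, nat_of_ord c).
Proof. exact: label_indexL. Qed.
Let rl_J y : rl (rJ y) = (l, reshape_index wJ y). Proof. exact: label_indexJ. Qed.
Let rl_N y : rl (rN y) = (l.+1, reshape_index wJ0 y). Proof. exact: label_indexN. Qed.
Let rl_R i (c : 'I_(q i)) : rl (rR (tagnat.Rank i c)) = (l + i.+2, nat_of_ord c).
Proof. exact: label_indexR. Qed.
Let cl_L i (c : 'I_(p i)) : cl (cL (tagnat.Rank i c)) = (nat_of_ord i, nat_of_ord c).
Proof. exact: label_indexL. Qed.
Let cl_J y : cl (cJ y) = (l, reshape_index wJ y). Proof. exact: label_indexJ. Qed.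
Let cl_N y : cl (cN y) = (l.+1, reshape_index wJ0 y). Proof. exact: label_indexN. Qed.
Let cl_R i (c : 'I_(q i).-1) :
  cl (cR (@tagnat.Rank _ (fun i => (q i).-1) i c)) = (l + i.+2, nat_of_ord c).
Proof. exact: label_indexR. Qed.

Ltac block_entry := rewrite /stars_A /stars_B /block4 /rL /rJ /rN /rR /cL /cJ /cN /cR
  /indexL /indexJ /indexN /indexR !(col_mxEu, col_mxEd) !(row_mxEl, row_mxEr).

(** It is enough to compare the entries of rows with equal labels and the entries
    of columns with equal labels, and to locate every star. *)
Lemma block_triangular_patternI d (S : 'M[bool]_(rdim, cdim)) :
  (forall i i' j, rl i = rl i' -> S i j = S i' j) ->
  (forall i j j', cl j = cl j' -> S i j = S i j') ->
  (forall i j, S i j -> (cl j).1 < (rl i).1 \/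
     [/\ (rl i).1 = d, (cl j).1 = d & (cl j).2 <= (rl i).2]) ->
  block_triangular_pattern rl cl d S.
Proof.
move=> hr hc hS; split=> [i i' j j' ri cj|i j /hS[/ltnW//|[-> ->//]]|i j /hS[]].
- by rewrite (hr _ _ _ ri) (hc _ _ _ cj).
- by move=> lt e; rewrite e ltnn in lt.
by case=> -> _ ? _.
Qed.

Lemma stars_A_pattern (H : 'M[bool]_n') :
  (forall x x' y y' : 'I_n', reshape_index wJ0 x = reshape_index wJ0 x' ->
     reshape_index wJ0 y = reshape_index wJ0 y' -> H x y = H x' y') ->
  (forall x y, H x y -> reshape_index wJ0 y <= reshape_index wJ0 x) ->
  block_triangular_pattern rl cl l.+1 (stars_A p q n H).
Proof.
move=> Hs Hl; apply: block_triangular_patternI => [i i' j|i j j'|i j].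
- case/rl_eq => [->//|[y [y' [-> -> E]]]|[y [y' [-> -> E]]]];
    case: (colP j) => -[z ->]; block_entry; rewrite ?mxE //.
  exact: Hs.
- case/cl_eq => [->//|[y [y' [-> -> E]]]|[y [y' [-> -> E]]]];
    case: (rowP i) => -[z ->]; block_entry; rewrite ?mxE //.
  exact: Hs.
case: (rowP i) => -[y ->]; case: (colP j) => -[z ->]; block_entry;
  try (by rewrite mxE).
- by move=> _; left; have [k [c ->]] := RankP z;
  rewrite rl_N cl_L /= ltnW // ltnS.
- by move=> /Hl yz; right; rewrite rl_N cl_N.
- move=> _; left; have [k [c ->]] := RankP z; have [k' [c' ->]] := RankP y.
  by rewrite rl_R cl_L /= ltn_addr.
by move=> _; left; have [k [c ->]] := RankP y;
  rewrite rl_R cl_N /= addnS ltnS addnS ltnS leq_addr.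
Qed.

Lemma stars_B_pattern (K : 'M[bool]_n) :
  (forall x x' y y' : 'I_n, reshape_index wJ x = reshape_index wJ x' ->
     reshape_index wJ y = reshape_index wJ y' -> K x y = K x' y') ->
  (forall x y, K x y -> reshape_index wJ y <= reshape_index wJ x) ->
  block_triangular_pattern rl cl l (stars_B p q n' K).
Proof.
move=> Ks Kl; apply: block_triangular_patternI => [i i' j|i j j'|i j].
- case/rl_eq => [->//|[y [y' [-> -> E]]]|[y [y' [-> -> E]]]];
    case: (colP j) => -[z ->]; block_entry; rewrite ?mxE //.
  exact: Ks.
- case/cl_eq => [->//|[y [y' [-> -> E]]]|[y [y' [-> -> E]]]];
    case: (rowP i) => -[z ->]; block_entry; rewrite ?mxE //.
  exact: Ks.
case: (rowP i) => -[y ->]; case: (colP j) => -[z ->]; block_entry;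
  try (by rewrite mxE).
- have [k [c ->]] := RankP y; have [k' [c' ->]] := RankP z;
  rewrite mxblock_Rank.
  by case: ltnP => [kk _|_]; [left; rewrite rl_L cl_L | rewrite mxE].
- by move=> _; left; have [k [c ->]] := RankP z; rewrite rl_J cl_L /=.
- by move=> /Kl yz; right; rewrite rl_J cl_J.
- move=> _; left; have [k [c ->]] := RankP z; have [k' [c' ->]] := RankP y.
  by rewrite rl_R cl_L /= ltn_addr.
- by move=> _; left; have [k [c ->]] := RankP y;
  rewrite rl_R cl_J /= addnS ltnS leq_addr.
have [k [c ->]] := RankP y; have [k' [c' ->]] := RankP z; rewrite mxblock_Rank.
case: ltnP => [kk _|_]; last by rewrite mxE.
by left; rewrite rl_R cl_R /= ltn_add2l !ltnS.
Qed.

End Patterns.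
End Labels.

Theorem theorem3p1 (R : realType) (l r : nat) (p : 'I_l -> nat) (q : 'I_r -> nat)
    (tau : nat) (lam : 'I_tau -> Cplx R) (t : 'I_tau -> nat)
    (nJ : forall c : 'I_tau, 'I_(t c) -> nat)
    (t0 : nat) (n0 : 'I_t0 -> nat) :
  (forall i, (0 < p i)%N) ->
  (forall i j : 'I_l, (i <= j)%N -> (p i <= p j)%N) ->
  (forall i, (0 < q i)%N) ->
  (forall i j : 'I_r, (i <= j)%N -> (q j <= q i)%N) ->
  injective lam ->
  (forall c i, (0 < nJ c i)%N) ->
  (forall c (i j : 'I_(t c)), (i <= j)%N -> (nJ c j <= nJ c i)%N) ->
  (forall i, (0 < n0 i)%N) ->
  (forall i j : 'I_t0, (i <= j)%N -> (n0 j <= n0 i)%N) ->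
  let J := \mxdiag_(c < tau) weyr_mx (lam c) (@nJ c) in
  let K := dsum false (fun c => weyr_stars (@nJ c)) in
  let J0 := weyr_mx (0 : Cplx R) n0 in
  let H := weyr_stars n0 in
  let wJ := flatten [seq weyr_partition (@nJ c) | c <- enum 'I_tau] in
  let wJ0 := weyr_partition n0 in
  let A := canon_A p q (\sum_c \sum_i nJ c i) J0 in
  let B := canon_B p q (\sum_i n0 i) J in
  exists (k : nat) (D : 'rV[Cplx R]_k -> mx_pair R _ _),
    [/\ star_deformation A B (stars_A p q _ H) (stars_B p q _ K) D,
        simple_deformation A B D,
        block_triangular (row_label wJ wJ0) (col_label wJ wJ0) l.+1 l A B D
      & miniversal A B D].
Proof.
move=> _ p_mono _ q_mono lam_inj _ nJ_mono _ n0_mono J K J0 H wJ wJ0 A B.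
have cmp : complement A B A B (stars_A p q _ H) (stars_B p q _ K).
  apply: complement_canon => //.
  - exact: graded_weyr_mx0.
  - exact: complement_weyr_sum lam_inj.
  - exact: complement_weyr_mx.
have [k [D [starD defD minD]]] := complement_star_miniversal cmp.
exists k, D; split=> //.
  by split=> //; exists (stars_A p q _ H), (stars_B p q _ K).
exists (stars_A p q _ H), (stars_B p q _ K); split=> //.
  apply: stars_A_pattern => [x x' y y'|x y].
    exact: weyr_stars_strips.
  exact: weyr_stars_lower.
apply: stars_B_pattern => [x x' y y'|x y].
  exact: dsum_weyr_stars_strips.
exact: dsum_weyr_stars_lower.
Qed.
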